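(* Let $\mathcal{P}=(P,d\mu,d\sigma)$ be a $2$-dimensional system. Then every $q\in\mathcal{E}^1(P)$ that minimizes the functional $q\mapsto\frac{\int_{\partial P}e^q\,d\sigma}{\int_Pe^q\,d\mu}$ over $\mathcal{E}^1(P)$ (equivalently, maximizes $\check{\mu}_{\mathrm{NA}}(q)=-2\pi\frac{\int_{\partial P}e^q\,d\sigma}{\int_Pe^q\,d\mu}$) is bounded and continuous on $P$. Equivalently, every minimizer of $U_{\mathcal{P}}$ on $\mathcal{M}^1(P)$ is bounded and continuous.
   Context: An $n$-dimensional system is a triple $\mathcal{P}=(P,d\mu,d\sigma)$ where $P$ is a simple polytope in an $n$-dimensional real affine space $V$ (a compact subset with non-empty interior that is a finite intersection of closed half spaces, such that every vertex is the intersection of exactly $n$ facets), $d\mu$ is the restriction to $P$ of a translation-invariant measure on $V$ that is positive and finite on bounded non-empty open sets (i.e. a positive multiple of Lebesgue measure), and $d\sigma$ is a measure on the boundary $\partial P$ whose restriction to each facet is a positive multiple of the Lebesgue measure of the affine hyperplane spanned by that facet. $\mathcal{E}^1(P)$ is the set of lower semicontinuous convex functions $q:P\to(-\infty,\infty]$ with $\int_Pe^q\,d\mu<\infty$. $\mathcal{M}^1(P)$ is the set of lower semicontinuous log-convex functions $u:P\to(0,\infty]$ with $\int_Pu\,d\mu=\int_Pd\mu$, and $U_{\mathcal{P}}(u):=\frac{1}{\int_Pd\mu}\int_{\partial P}u\,d\sigma$. *)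

(* Defs.v *)
From HB Require Import structures.
From mathcomp Require Import all_boot all_order all_algebra.
From mathcomp Require Import all_classical all_reals all_analysis.
Set Implicit Arguments. Unset Strict Implicit. Unset Printing Implicit Defensive.
Import Order.TTheory GRing.Theory Num.Theory.
Import numFieldNormedType.Exports.
Local Open Scope classical_set_scope.
Local Open Scope ring_scope.

Section Polygon.
Variable R : realType.
(* The 2-dimensional affine space V is identified with R^2 = R * R. *)

Definition padd (a b : R * R) : R * R := (a.1 + b.1, a.2 + b.2).
Definition psub (a b : R * R) : R * R := (a.1 - b.1, a.2 - b.2).
Definition pscale (t : R) (a : R * R) : R * R := (t * a.1, t * a.2).
Definition cross (a b : R * R) : R := a.1 * b.2 - a.2 * b.1.
Definition plen (a : R * R) : R := Num.sqrt (a.1 ^+ 2 + a.2 ^+ 2).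

(* v : 'I_m -> R*R lists the vertices of a convex polygon in
   counterclockwise order: every other vertex lies strictly to the left
   of the (directed) line through each edge [v i, v (i+1)]. *)
Definition ccw_convex_polygon (m : nat) (v : 'I_m -> R * R) : Prop :=
  (3 <= m)%N /\
  forall i j : 'I_m, j != i -> j != ordS i ->
    0 < cross (psub (v (ordS i)) (v i)) (psub (v j) (v i)).

Definition polygon (m : nat) (v : 'I_m -> R * R) : set (R * R) :=
  [set x | forall i : 'I_m, 0 <= cross (psub (v (ordS i)) (v i)) (psub x (v i))].

Definition edge_pt (m : nat) (v : 'I_m -> R * R) (i : 'I_m) (t : R) : R * R :=
  padd (v i) (pscale t (psub (v (ordS i)) (v i))).

Local Open Scope ereal_scope.

(* d mu = c * (Lebesgue measure on R^2), c > 0. *)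
Definition leb2 := ((@lebesgue_measure R) \x (@lebesgue_measure R))%E.

Definition mu_int (c : R) (P : set (R * R)) (f : R * R -> \bar R) : \bar R :=
  c%:E * \int[leb2]_(x in P) f x.

(* d sigma restricted to the i-th edge = c_i * (arclength measure).
   The arclength integral over the edge is parametrized by t in [0,1]. *)
Definition sigma_int (m : nat) (v : 'I_m -> R * R) (cs : 'I_m -> R)
    (f : R * R -> \bar R) : \bar R :=
  \sum_(i < m) ((cs i)%:E * (plen (psub (v (ordS i)) (v i)))%:E *
     \int[@lebesgue_measure R]_(t in `[0%R, 1%R]) f (edge_pt v i t)).

Definition lsc_on (P : set (R * R)) (f : R * R -> \bar R) : Prop :=
  forall x, P x -> forall a : R, a%:E < f x ->
    exists2 V, nbhs x V & forall y, V y -> P y -> a%:E < f y.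

(* convexity on P of a function with values in (-oo, +oo] *)
Definition convex_on (P : set (R * R)) (f : R * R -> \bar R) : Prop :=
  forall x y, P x -> P y -> forall t : R, (0 < t < 1)%R ->
    f (padd (pscale t x) (pscale (1 - t) y)) <= t%:E * f x + (1 - t)%:E * f y.

Definition E1 (c : R) (P : set (R * R)) (q : R * R -> \bar R) : Prop :=
  (forall x, P x -> q x != -oo) /\ lsc_on P q /\ convex_on P q /\
  mu_int c P (fun x => expeR (q x)) < +oo.

Definition ratio_functional (c : R) (m : nat) (v : 'I_m -> R * R) (cs : 'I_m -> R)
    (q : R * R -> \bar R) : \bar R :=
  sigma_int v cs (fun x => expeR (q x)) *
  ((fine (mu_int c (polygon v) (fun x => expeR (q x))))^-1)%:E.

Definition M1 (c : R) (P : set (R * R)) (u : R * R -> \bar R) : Prop :=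
  (forall x, P x -> 0 < u x) /\ lsc_on P u /\ convex_on P (fun x => lne (u x)) /\
  mu_int c P u = mu_int c P (fun _ => 1%E).

Definition U_functional (c : R) (m : nat) (v : 'I_m -> R * R) (cs : 'I_m -> R)
    (u : R * R -> \bar R) : \bar R :=
  ((fine (mu_int c (polygon v) (fun _ => 1%E)))^-1)%:E * sigma_int v cs u.

Definition bounded_continuous_on (P : set (R * R)) (f : R * R -> \bar R) : Prop :=
  exists g : R * R -> R,
    (forall x, P x -> f x = (g x)%:E) /\
    {within P, continuous g} /\
    (exists M : R, forall x, P x -> (`|g x| <= M)%R).

End Polygon.

(* Main.v *)
Require Import Defs.
From HB Require Import structures.
From mathcomp Require Import all_boot all_order all_algebra.
From mathcomp Require Import all_classical all_reals all_analysis.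
From mathcomp Require Import measurable_realfun ring lra.
Import Order.TTheory GRing.Theory Num.Theory.
Import numFieldNormedType.Exports.
Local Open Scope classical_set_scope.
Local Open Scope ring_scope.
Set Implicit Arguments. Unset Strict Implicit. Unset Printing Implicit Defensive.

(** Since [exp q] is integrable on the edges, convexity makes [q] finite there
except possibly at the vertices; once [q] is finite at the vertices as well, it
is upper semicontinuous on the polygon, hence continuous and bounded.

Suppose [q = +oo] at a vertex, and let [w] point from that vertex into [P].
Replace [q] by its inf-convolution [q_k x = inf_(t >= 0) q (x + t w) + k t].
The defect [D = exp q - exp q_k] is nonincreasing along [w], and for [k] large
it vanishes at all points at depth at least [e |w|] in the direction [w],
because [q] is bounded away from the vertices.  Integrating along the lines
parallel to [w] gives [int_P D <= C e int_(boundary) D] with [C] independent of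
[e].  Minimality of [q] then forces [int_P exp q <= C e int_(boundary) exp q]
unless [D] vanishes a.e. on the boundary.  The former is false for small [e],
and the latter would keep [q] bounded near the vertex along an edge. *)

(** * Polygons *)

Section polygon_geometry.
Variable R : realType.
Implicit Types (x y z w d : R * R) (t s : R).

(** Truncating [q] at a constant would destroy convexity; the inf-convolution along one direction
    stays convex and lower semicontinuous and lies below [q], so it is an admissible competitor. The
    estimate runs over the whole polygon at once, so nothing has to be localized at the bad vertex,
    and other vertices may be bad as well.

    Write [s] and [a] for the integrals of [exp q] over the boundary and over [P], and [d] and [l]
    for the parts lost to the defect. Minimality says [d / s <= l / a]: relatively, the boundary
    loses no more than the interior. But the defect lives in a layer of depth [e], which gives
    [l <= C e d]. Once [d > 0], this forces [a <= C e s]. The order of the choices matters: [C]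
    depends on [w] and the weights only, [e] is then fixed by [C], [s] and [a], and [k] comes last,
    from the bound of [q] at points kept away from the vertices by a distance depending on [e]. *)

Definition ray x w t : R * R := padd x (pscale t w).

Lemma ray_ray (x w : R * R) s t : ray (ray x w s) w t = ray x w (s + t).
Proof. by rewrite /ray /padd /pscale /=; congr pair; ring. Qed.

Lemma ray0 (x w : R * R) : ray x w 0 = x.
Proof. by case: x => a b; rewrite /ray /padd /pscale /=; congr pair; ring. Qed.

(** Along a half line finitely many affine constraints [A i + s * B i] evolve; the least ratio
    [A i / - B i] among the decreasing ones is the time at which the first of them becomes tight. *)
Lemma exit_time (I : finType) (A B : I -> R) (i1 : I) :
  (forall i, 0 <= A i) -> B i1 < 0 ->
  exists s i0, [/\ 0 <= s, forall i, 0 <= A i + s * B i, B i0 < 0 &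
     A i0 + s * B i0 = 0].
Proof.
move=> A0 Bi1.
case: (@arg_minP _ _ I i1 (fun i => B i < 0) (fun i => A i / (- B i)) Bi1) => i0 B0 mn.
exists (A i0 / (- B i0)), i0; split=> //.
- by rewrite divr_ge0// oppr_ge0 ltW.
- move=> i; have [Bi|Bi] := ltP (B i) 0; last first.
    by rewrite addr_ge0// mulr_ge0// divr_ge0// oppr_ge0 ltW.
  have := mn i Bi; rewrite ler_pdivlMr ?oppr_gt0//; lra.
- by field; rewrite lt_eqF.
Qed.

(** Turns finitely many positive margins into one constant. The bound [2^-1] keeps the parameters
    [d] and [1 - d] on an edge in order. *)
Lemma uniform_scale (I : finType) (a g : I -> R) :
  (forall i, 0 <= a i) -> (forall i, 0 < g i) ->
  exists2 d, 0 < d < 2^-1 & forall i, d * a i <= g i.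
Proof.
move=> a0 g0; set s := \sum_i a i / g i.
have s0 : 0 <= s by apply: sumr_ge0 => i _; rewrite divr_ge0// ltW.
have s1 : 0 < 4 * (1 + s) by rewrite mulr_gt0// ltr_wpDr.
exists (4 * (1 + s))^-1.
  rewrite invr_gt0 s1/= ltf_pV2 ?posrE//; lra.
move=> i; rewrite ler_pdivrMl//.
have : a i / g i <= s.
  rewrite /s (bigD1 i)//= lerDl; apply: sumr_ge0 => j _.
  by rewrite divr_ge0// ltW.
rewrite ler_pdivrMr// => H; apply: (le_trans H).
by rewrite ler_wpM2r ?ltW//; lra.
Qed.

Section polygon.
Variables (m : nat) (v : 'I_m -> R * R).
Hypothesis vP : ccw_convex_polygon v.
Let P := polygon v.
(** Up to the length of edge [i], the signed distance to its line, positive inside. [slope i] is the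
    linear part, and [turn i], the determinant of two consecutive edge vectors, is the height of the
    vertex after edge [i]. *)
Definition hgt (i : 'I_m) x := cross (psub (v (ordS i)) (v i)) (psub x (v i)).
Definition slope (i : 'I_m) w := cross (psub (v (ordS i)) (v i)) w.
Definition turn (i : 'I_m) := slope i (psub (v (ordS (ordS i))) (v (ordS i))).

Lemma hgt_ray i x w t : hgt i (ray x w t) = hgt i x + t * slope i w.
Proof. by rewrite /hgt /slope /ray /cross /padd /psub /pscale /=; ring. Qed.

Lemma hgt_conv i x y t :
  hgt i (padd (pscale t x) (pscale (1 - t) y)) = t * hgt i x + (1 - t) * hgt i y.
Proof. by rewrite /hgt /cross /padd /psub /pscale /=; ring. Qed.

Lemma hgt_vertex i j : 0 <= hgt i (v j).
Proof.
case: vP => _ vv; rewrite /hgt.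
have [->|ji] := eqVneq j i.
  by rewrite /cross /psub /= !subrr !mulr0 subrr.
have [->|jSi] := eqVneq j (ordS i); last by rewrite ltW// vv.
by rewrite /cross /psub /= mulrC subrr.
Qed.

Lemma polygon_vertex j : P (v j).
Proof. by move=> i; exact: hgt_vertex. Qed.

Lemma polygon_conv x y t : P x -> P y -> 0 <= t <= 1 ->
  P (padd (pscale t x) (pscale (1 - t) y)).
Proof.
move=> Px Py /andP[t0 t1] i; have := hgt_conv i x y t; rewrite /hgt => ->.
by rewrite addr_ge0// mulr_ge0// ?Px ?Py// subr_ge0.
Qed.

Lemma ordS_neq (i : 'I_m) : ordS i != i.
Proof.
case: vP => m3 _; apply/eqP => /(congr1 val)/=.
have := ltn_ord i; move: (nat_of_ord i) => k km.
have [kn|kn] := ltnP k.+1 m.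
  by rewrite modn_small// => /eqP; rewrite -{2}[k]addn0 -addn1 eqn_add2l.
have -> : k.+1 = m by apply/eqP; rewrite eqn_leq kn km.
rewrite modnn => k0; move: kn; rewrite -k0 => m1.
by have := leq_trans m3 m1.
Qed.

Lemma ordSS_neq (i : 'I_m) : ordS (ordS i) != i.
Proof.
case: vP => m3 _; apply/eqP => /(congr1 val)/=.
rewrite -addn1 modnDml addn1.
have := ltn_ord i; move: (nat_of_ord i) => k km.
have [kn|kn] := ltnP k.+2 m.
  by rewrite modn_small// => /eqP; rewrite -{2}[k]addn0 -addn2 eqn_add2l.
have : (k.+2 = m \/ k.+1 = m)%N.
  move: km kn; rewrite leq_eqVlt => /orP[/eqP->|]; first by right.
  by move=> h1 h2; left; apply/eqP; rewrite eqn_leq h1 h2.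
case=> Hm.
  by rewrite Hm modnn => k0; move: m3; rewrite -Hm -k0.
rewrite -addn1 Hm modnDl modn_small; last exact: leq_trans m3.
by move=> k1; move: m3; rewrite -Hm -k1.
Qed.

Lemma turn_gt0 i : 0 < turn i.
Proof.
case: vP => _ vv.
have := vv i (ordS (ordS i)) (ordSS_neq i) (ordS_neq (ordS i)).
by rewrite /turn /slope /cross /psub /= => h; apply: (lt_le_trans h); lra.
Qed.

(** Cramer's rule: the determinant [turn i] of the edge vectors [i] and [ordS i] is nonzero. *)
Lemma slope_indep i w : slope i w = 0 -> slope (ordS i) w = 0 -> w = (0, 0).
Proof.
move=> h1 h2; have t0 := turn_gt0 i.
have w1 : turn i * w.1 = 0.
  transitivity ((v (ordS (ordS i))).1 * slope i w - (v (ordS i)).1 * slope i w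
    - (v (ordS i)).1 * slope (ordS i) w + (v i).1 * slope (ordS i) w).
    by rewrite /turn /slope /cross /psub /=; ring.
  by rewrite h1 h2; ring.
have w2 : turn i * w.2 = 0.
  transitivity ((v (ordS (ordS i))).2 * slope i w - (v (ordS i)).2 * slope i w
    - (v (ordS i)).2 * slope (ordS i) w + (v i).2 * slope (ordS i) w).
    by rewrite /turn /slope /cross /psub /=; ring.
  by rewrite h1 h2; ring.
move/eqP: w1; rewrite mulf_eq0 (gt_eqF t0)/= => /eqP w1.
move/eqP: w2; rewrite mulf_eq0 (gt_eqF t0)/= => /eqP w2.
by rewrite (surjective_pairing w) w1 w2.
Qed.

Lemma sum_slope w : \sum_i slope i w = 0.
Proof.
have sh (f : 'I_m -> R) : \sum_i f (ordS i) = \sum_i f i.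
  by rewrite [RHS](reindex_inj (@ordS_inj m)).
under eq_bigr do rewrite /slope /cross /psub /=.
rewrite big_split/= sumrN -!mulr_suml !sumrB.
have := sh (fun i => (v i).1); have := sh (fun i => (v i).2) => /= -> ->.
by rewrite !subrr; ring.
Qed.

(** The slopes sum to zero, so if none were negative all would vanish, against [slope_indep].
    Consequently every half line leaves the polygon. *)
Lemma slope_neg w : w != (0, 0) -> exists i, slope i w < 0.
Proof.
move=> w0; apply: contrapT => /forallNP h.
have s0 i : 0 <= slope i w by rewrite leNgt; apply/negP/h.
have z : forall i, slope i w = 0.
  move=> i; apply/eqP; rewrite eq_le s0 andbT -(sum_slope w).
  by rewrite (bigD1 i)//= lerDl sumr_ge0.
case: vP => m3 _; have i : 'I_m by exact: (Ordinal (leq_trans (isT : (0 < 3)%N) m3)).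
by move/eqP: w0; apply; exact: (slope_indep (z i) (z (ordS i))).
Qed.

Lemma edge_convE i t : edge_pt v i t = padd (pscale t (v (ordS i))) (pscale (1 - t) (v i)).
Proof. by rewrite /edge_pt /padd /psub /pscale /=; congr pair; ring. Qed.

Lemma polygon_edge i t : 0 <= t <= 1 -> P (edge_pt v i t).
Proof. by move=> t01; rewrite edge_convE; apply: polygon_conv => //; exact: polygon_vertex. Qed.

(** Affine coordinates at the vertex [v (ordS i)] along its two edges: each height, divided by
    [turn i], is the coordinate along the other edge. *)
Lemma corner_coord i z :
  z = padd (padd (v (ordS i)) (pscale (hgt i z / turn i) (psub (v (ordS (ordS i))) (v (ordS i)))))
       (pscale (- (hgt (ordS i) z / turn i)) (psub (v (ordS i)) (v i))).
Proof.
have t0 : turn i != 0 by rewrite gt_eqF// turn_gt0.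
rewrite [LHS]surjective_pairing; move: t0.
rewrite /turn /slope /hgt /cross /padd /psub /pscale /= => t0.
by congr pair; field.
Qed.

(* [hgt (ordS i)] vanishes at [v (ordS i)] and has slope [- turn i] along edge [i]. *)
Lemma edge_param i z : hgt i z = 0 -> z = edge_pt v i (1 - hgt (ordS i) z / turn i).
Proof.
move=> z0; rewrite {1}(corner_coord i z) z0 mul0r.
by rewrite /edge_pt /padd /psub /pscale /=; congr pair; ring.
Qed.

Lemma hgt_prev_edge i t : hgt i (edge_pt v (ordS i) t) = t * turn i.
Proof. by rewrite /hgt /turn /slope /edge_pt /cross /padd /psub /pscale/=; ring. Qed.

Lemma hgt_next_edge i t : hgt (ordS i) (edge_pt v i t) = (1 - t) * turn i.
Proof. by rewrite /hgt /turn /slope /edge_pt /cross /padd /psub /pscale/=; ring. Qed.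

(** The heights over the two neighbouring edges are linear in the parameter; the previous edge gives
    [0 <= t] and the next one [t <= 1]. *)
Lemma boundary_edge i z : P z -> hgt i z = 0 ->
  exists2 t, 0 <= t <= 1 & z = edge_pt v i t.
Proof.
move=> Pz z0; have zE := edge_param z0.
move: zE; set t := 1 - _ => zE; exists t => //.
apply/andP; split.
  have := Pz (ord_pred i); rewrite -/(hgt _ _) zE -{2}(ord_predK i) hgt_prev_edge.
  by rewrite pmulr_lge0// turn_gt0.
by rewrite /t lerBlDl lerDr divr_ge0 ?(ltW (turn_gt0 i))// Pz.
Qed.

(* [hgt i + hgt (ordS i)] equals [turn i] at both neighbours of the vertex
[v (ordS i)], so a corner triangle of relative size [D] is cut off at each vertex. *)
Definition trimmed (D : R) x := P x /\ forall i, D * turn i <= hgt i x + hgt (ordS i) x.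

Lemma trimmed0 x : P x -> trimmed 0 x.
Proof. by move=> Px; split=> // i; rewrite mul0r addr_ge0// Px. Qed.

(** * Upper bounds of convex functions from finitely many points *)

Section convex.
Variable f : R * R -> \bar R.
Hypothesis cf : convex_on P f.

(** [convex_on] concerns [0 < t < 1] only, so the end points are treated apart. Real upper bounds
    [A] and [B] avoid products such as [0 * +oo]. *)
Lemma convex_on_ub x y t A B : P x -> P y -> 0 <= t <= 1 ->
  (f x <= A%:E)%E -> (f y <= B%:E)%E ->
  (f (padd (pscale t x) (pscale (1 - t) y)) <= (t * A + (1 - t) * B)%:E)%E.
Proof.
move=> Px Py /andP[]; rewrite le_eqVlt => /predU1P[<- _ _ fy|t0].
  rewrite subr0 mul0r mul1r add0r (_ : padd _ _ = y)//.
  by case: y {Py fy} => a b; rewrite /padd /pscale/=; congr pair; ring.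
rewrite le_eqVlt => /predU1P[-> fx _|t1 fx fy].
  rewrite subrr mul1r mul0r addr0 (_ : padd _ _ = x)//.
  by case: x {Px fx} => a b; rewrite /padd /pscale/=; congr pair; ring.
have t01 : 0 < t < 1 by rewrite t0.
apply: (le_trans (cf Px Py t01)); rewrite [leRHS]EFinD (EFinM t A) (EFinM (1 - t) B).
apply: leeD; apply: lee_wpmul2l => //; rewrite lee_fin ?subr_ge0 ltW//.
Qed.

Lemma convex_on_ray x w s t A B : P x -> P (ray x w s) -> 0 < s -> 0 <= t <= s ->
  (f x <= A%:E)%E -> (f (ray x w s) <= B%:E)%E ->
  (f (ray x w t) <= (A + t / s * (B - A))%:E)%E.
Proof.
move=> Px Py s0 /andP[t0 ts] fx fy.
have ts1 : 0 <= t / s <= 1 by rewrite divr_ge0 ?(ltW s0)//= ler_pdivrMr// mul1r.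
have := convex_on_ub Py Px ts1 fy fx.
have -> : padd (pscale (t / s) (ray x w s)) (pscale (1 - t / s) x) = ray x w t.
  by rewrite /ray /padd /pscale/=; congr pair; field; rewrite gt_eqF.
by move=> /le_trans; apply; rewrite lee_fin; lra.
Qed.

Lemma convex_on_le x y t B : P x -> P y -> 0 <= t <= 1 ->
  (f x <= B%:E)%E -> (f y <= B%:E)%E ->
  (f (padd (pscale t x) (pscale (1 - t) y)) <= B%:E)%E.
Proof.
move=> Px Py t01 fx fy; apply: le_trans (convex_on_ub Px Py t01 fx fy) _.
by rewrite lee_fin; lra.
Qed.

Lemma convex_on_edge i a b t B : 0 <= a <= t -> t <= b <= 1 ->
  (f (edge_pt v i a) <= B%:E)%E -> (f (edge_pt v i b) <= B%:E)%E ->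
  (f (edge_pt v i t) <= B%:E)%E.
Proof.
move=> /andP[a0 at_] /andP[tb b1] fa fb.
have [ab|ab] := eqVneq a b.
  by have -> : t = a by apply/eqP; rewrite eq_le at_ ab tb.
have ab' : 0 < b - a by rewrite subr_gt0 lt_neqAle ab (le_trans at_).
set s := (b - t) / (b - a).
have -> : edge_pt v i t = padd (pscale s (edge_pt v i a)) (pscale (1 - s) (edge_pt v i b)).
  rewrite /s /edge_pt /padd /psub /pscale/=; congr pair; field; exact: lt0r_neq0.
apply: convex_on_le => //; try (apply: polygon_edge; lra).
rewrite /s divr_ge0 ?(ltW ab') ?subr_ge0//= ler_pdivrMr//; lra.
Qed.

(* The extreme points of [trimmed D] are the points of parameters [D] and [1 - D] on the edges. *)
Lemma trimmed_ub (D B : R) : 0 <= D < 2^-1 ->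
  (forall i, f (edge_pt v i D) <= B%:E)%E -> (forall i, f (edge_pt v i (1 - D)) <= B%:E)%E ->
  forall x, trimmed D x -> (f x <= B%:E)%E.
Proof.
move=> /andP[D0 D1] fD f1D.
(* Boundary of the trimmed polygon: a point on a cut is a convex combination of the two ends of the
   cut, and a point on edge [i] has its parameter in [[D, 1 - D]]. *)
have bd z : trimmed D z -> (exists i, hgt i z = 0 \/ hgt i z + hgt (ordS i) z = D * turn i) ->
    (f z <= B%:E)%E.
  move=> [Pz Dz] [i zi].
  have corner j : hgt j z + hgt (ordS j) z = D * turn j -> (f z <= B%:E)%E.
    move=> {zi} zj; have tj := turn_gt0 j; have tn := lt0r_neq0 tj.
    (* For [D = 0] the cut shrinks to the vertex and division by [D] is impossible. *)
    move: D0; rewrite le_eqVlt => /predU1P[D0|D0].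
      have [h0 h1] : hgt j z = 0 /\ hgt (ordS j) z = 0.
        have h1 : 0 <= hgt j z := Pz j; have h2 : 0 <= hgt (ordS j) z := Pz (ordS j).
        by move: zj; rewrite -D0 mul0r => zj; split; lra.
      rewrite (corner_coord j z) h0 h1 !mul0r oppr0.
      move: (fD (ordS j)); rewrite -D0 /edge_pt /padd /pscale /=.
      by rewrite !mul0r !addr0.
    set a := hgt j z / turn j; set b := hgt (ordS j) z / turn j.
    have abD : a + b = D by rewrite /a /b -mulrDl zj mulfK.
    have a0 : 0 <= a by rewrite divr_ge0 ?(ltW tj)//; exact: Pz.
    have b0 : 0 <= b by rewrite divr_ge0 ?(ltW tj)//; exact: Pz.
    have -> : z = padd (pscale (a / D) (edge_pt v (ordS j) D))
        (pscale (1 - a / D) (edge_pt v j (1 - D))).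
      rewrite (corner_coord j z) -/a -/b /edge_pt /padd /pscale /psub/=.
      have -> : b = D - a by lra.
      by congr pair; field; rewrite gt_eqF.
    apply: convex_on_le => //; try (apply: polygon_edge; lra).
    rewrite divr_ge0 ?(ltW D0)//= ler_pdivrMr//; lra.
  case: zi => [zi|]; last exact: corner.
  have [t t01 zE] := boundary_edge Pz zi.
  have ti := turn_gt0 i; have tp := turn_gt0 (ord_pred i).
  rewrite zE; apply: (convex_on_edge (a := D) (b := 1 - D)) => //.
    move: (Dz (ord_pred i)); rewrite ord_predK zi addr0 zE.
    have := hgt_prev_edge (ord_pred i) t; rewrite ord_predK => ->.
    by rewrite ler_pM2r// D0 => ->.
  have := Dz i; rewrite zi add0r zE hgt_next_edge ler_pM2r//; lra.
(* The edge constraints and the cut constraints are put into one family indexed by a sum type; the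
   first to become tight is one of the two cases of [bd]. *)
have exits x d : trimmed D x -> d != (0, 0) ->
    exists2 s, 0 <= s & trimmed D (ray x d s) /\ (f (ray x d s) <= B%:E)%E.
  move=> [Px Dx] d0; have [i1 di1] := slope_neg d0.
  pose A (i : 'I_m + 'I_m) := match i with inl i => hgt i x
    | inr i => hgt i x + hgt (ordS i) x - D * turn i end.
  pose C (i : 'I_m + 'I_m) := match i with inl i => slope i d
    | inr i => slope i d + slope (ordS i) d end.
  have [||s [i0 [s0 sA Ci0 AC0]]] := @exit_time _ A C (inl i1) => //.
    by case=> i /=; [exact: Px | rewrite subr_ge0; exact: Dx].
  have tr : trimmed D (ray x d s).
    split=> i; first by have := sA (inl i); rewrite /= -hgt_ray.
    by have := sA (inr i); rewrite /= !hgt_ray; lra.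
  exists s => //; split=> //; apply: bd => //.
  case: i0 AC0 {Ci0} => i /= h; exists i; first by left; rewrite hgt_ray.
  by right; rewrite !hgt_ray; lra.
have nz (a : R) : a != 0 -> (a, 0) != (0, 0) :> R * R by rewrite xpair_eqE eqxx andbT.
(* An arbitrary point lies between the two exit points of the horizontal line through it. *)
move=> x Dx.
have [s s0 [[Ps _] fs]] := exits x (1, 0) Dx (nz _ (oner_neq0 _)).
have n1 : -1 != 0 :> R by rewrite oppr_eq0 oner_eq0.
have [r r0 [[Pr _] fr]] := exits x (-1, 0) Dx (nz _ n1).
have [sr|] := eqVneq (s + r) 0.
  have sE : s = 0 by lra.
  by move: fs; rewrite sE ray0.
move=> srn; have sr : 0 < s + r by rewrite lt_neqAle eq_sym srn addr_ge0.
have -> : x = padd (pscale (r / (s + r)) (ray x (1, 0) s))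
    (pscale (1 - r / (s + r)) (ray x (-1, 0) r)).
  by rewrite {1}[x]surjective_pairing /ray /padd /pscale/=; congr pair; field.
apply: convex_on_le => //.
by rewrite divr_ge0 ?(ltW sr)//= ler_pdivrMr//; lra.
Qed.

Lemma polygon_ub (B : R) : (forall i, f (v i) <= B%:E)%E ->
  forall x, P x -> (f x <= B%:E)%E.
Proof.
move=> fv x Px; apply: (trimmed_ub (D := 0)); last exact: trimmed0.
- by rewrite lexx invr_gt0 ltr0n.
- by move=> i; rewrite edge_convE; apply: convex_on_le; rewrite ?lexx ?ler01//; exact: polygon_vertex.
- by move=> i; rewrite edge_convE; apply: convex_on_le; rewrite ?subr0 ?lexx ?ler01//; exact: polygon_vertex.
Qed.

End convex.

(** If [y + e w] and [y - e w] have nonnegative heights, then [hgt i y >= e |slope i w|], and by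
    [slope_indep] two consecutive slopes never vanish together. So the midpoints of all segments
    [2 e w] in the polygon avoid the vertices uniformly. *)
Lemma trimmed_midpoint w (e : R) : w != (0, 0) -> 0 < e ->
  exists2 D, 0 < D < 2^-1 &
    forall y, P (ray y w e) -> P (ray y w (- e)) -> trimmed D y.
Proof.
move=> w0 e0.
have g0 i : 0 < e * (`|slope i w| + `|slope (ordS i) w|).
  rewrite mulr_gt0// lt_neqAle addr_ge0// andbT eq_sym paddr_eq0// !normr_eq0.
  by apply/negP => /andP[/eqP h1 /eqP h2]; move: w0; rewrite (slope_indep h1 h2) eqxx.
have [D D01 hD] := uniform_scale (fun i => ltW (turn_gt0 i)) g0.
exists D => // y Py Py'.
have h i : e * `|slope i w| <= hgt i y.
  have := Py i; have := Py' i; rewrite -!/(hgt _ _) !hgt_ray => h1 h2.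
  by case: (ger0P (slope i w)) => _; lra.
split; first by move=> i; exact: le_trans (mulr_ge0 (ltW e0) (normr_ge0 _)) (h i).
by move=> i; apply: le_trans (hD i) _; have := h i; have := h (ordS i); lra.
Qed.

(** The coordinates and their negatives are affine, hence convex, and [polygon_ub] bounds them by
    their values at the vertices. *)
Lemma polygon_bounded : exists L : R, forall x, P x -> `|x.1| <= L /\ `|x.2| <= L.
Proof.
exists (\sum_i (`|(v i).1| + `|(v i).2|)) => x Px.
have aff (g : R * R -> R) : (forall x y t, g (padd (pscale t x) (pscale (1 - t) y)) =
     t * g x + (1 - t) * g y) -> (forall i, g (v i) <= `|(v i).1| + `|(v i).2|) ->
     g x <= \sum_i (`|(v i).1| + `|(v i).2|).
  move=> ga gv; rewrite -lee_fin; apply: (polygon_ub (f := EFin \o g)) => //.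
    by move=> y z _ _ t _; rewrite /= ga -!EFinM -EFinD.
  move=> i; rewrite /= lee_fin; apply: (le_trans (gv i)).
  by rewrite (bigD1 i)//= lerDl; apply: sumr_ge0 => j _; exact: addr_ge0.
rewrite !ler_norml; split; apply/andP; split.
- rewrite lerNl; apply: (aff (fun x => - x.1)) => [y z t|i]; first by rewrite /padd/=; lra.
  by rewrite -[leLHS]addr0 lerD// -normrN ler_norm.
- apply: (aff fst) => [y z t|i]; first by rewrite /padd/=; lra.
  by rewrite -[leLHS]addr0 lerD// ler_norm.
- rewrite lerNl; apply: (aff (fun x => - x.2)) => [y z t|i]; first by rewrite /padd/=; lra.
  by rewrite -[leLHS]add0r lerD// -normrN ler_norm.
- apply: (aff snd) => [y z t|i]; first by rewrite /padd/=; lra.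
  by rewrite -[leLHS]add0r lerD// ler_norm.
Qed.

(** The mean of the vertices: its height over edge [i] is the mean of nonnegative heights, and that
    of [v (ordS (ordS i))] is positive. *)
Lemma interior_point : exists c, forall i, 0 < hgt i c.
Proof.
have m0 : (0 < m)%N by case: vP => m3 _; exact: (leq_trans (isT : (0 < 3)%N) m3).
have mR : 0 < m%:R :> R by rewrite ltr0n.
exists (pscale m%:R^-1 (\sum_i (v i).1, \sum_i (v i).2)) => i.
have hE : m%:R * hgt i (pscale m%:R^-1 (\sum_i (v i).1, \sum_i (v i).2)) = \sum_j hgt i (v j).
  rewrite /hgt /cross /psub /pscale/= big_split/= sumrN -!mulr_sumr !sumrB !sumr_const.
  rewrite card_ord -[_ *+ m]mulr_natr -[(v i).1 *+ m]mulr_natr; field; exact: lt0r_neq0.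
rewrite -(pmulr_rgt0 _ mR) hE (bigD1 (ordS (ordS i)))//= ltr_pwDl//.
  by case: vP => _ vv; apply: vv; [exact: ordSS_neq|exact: ordS_neq].
by apply: sumr_ge0 => j _; exact: hgt_vertex.
Qed.

Lemma polygon_box : exists c r, 0 < r /\
  forall x, `|x.1 - c.1| <= r -> `|x.2 - c.2| <= r -> P x.
Proof.
have [c hc] := interior_point.
have [r /andP[r0 _] rh] := @uniform_scale _ (fun i => `|slope i (1, 0)| + `|slope i (0, 1)|) _
  (fun i => addr_ge0 (normr_ge0 _) (normr_ge0 _)) hc.
exists c, r; split=> // x x1 x2 i; rewrite -/(hgt i x).
have -> : hgt i x = hgt i c + ((x.1 - c.1) * slope i (1, 0) + (x.2 - c.2) * slope i (0, 1)).
  by rewrite /hgt /slope /cross /psub/=; ring.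
rewrite -lerBlDl sub0r lerNl; apply: le_trans (rh i).
rewrite opprD; apply: (le_trans (ler_norm _)); apply: (le_trans (ler_normB _ _)).
by rewrite !normrN !normrM mulrDr lerD// ler_wpM2r.
Qed.

(** The condition [w.1 != 0] lets lines of direction [w] be parametrized by the first coordinate.
    The vector points to the centre of a box inside the polygon, or to a side of it when the centre
    is vertically aligned with the vertex. *)
Lemma inner_direction j : exists2 w, w.1 != 0 & P (ray (v j) w 1).
Proof.
have [c [r [r0 cr]]] := polygon_box.
have d x : `|x.1 - c.1| <= r -> `|x.2 - c.2| <= r -> P (ray (v j) (psub x (v j)) 1).
  move=> h1 h2; have -> : ray (v j) (psub x (v j)) 1 = x; last exact: cr.
  by rewrite [RHS]surjective_pairing /ray /padd /psub /pscale/=; congr pair; ring.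
have [cv|cv] := eqVneq c.1 (v j).1.
  exists (psub (c.1 + r, c.2) (v j)); first by rewrite /psub/= -cv addrAC subrr add0r gt_eqF.
  by apply: d => /=; rewrite ?subrr ?normr0 ?(ltW r0)// addrAC subrr add0r gtr0_norm.
exists (psub c (v j)); first by rewrite /psub/= subr_eq0.
by apply: d; rewrite subrr normr0 ltW.
Qed.

End polygon.
End polygon_geometry.

(** * Lebesgue measure on the plane *)

Section plane_measure.
Variable R : realType.
Local Open Scope ereal_scope.
Notation mu := (@lebesgue_measure R).

(** The product sigma-algebra comes from rectangles; an open set is the union of the countably many
    squares with rational centre and half side [1 / (n + 1)] that it contains. *)
Lemma open_measurable_prod (U : set (R * R)) : open U -> measurable U.
Proof.
move=> oU.
pose B (p : rat * rat * nat) : set (R * R) :=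
  (`](ratr p.1.1 - p.2.+1%:R^-1)%R, (ratr p.1.1 + p.2.+1%:R^-1)%R[%classic : set R) `*`
  (`](ratr p.1.2 - p.2.+1%:R^-1)%R, (ratr p.1.2 + p.2.+1%:R^-1)%R[%classic : set R).
have -> : U = \bigcup_(p in [set p | B p `<=` U]) B p.
  apply/seteqP; split; last by move=> x [p pU Bx]; exact: pU.
  move=> x Ux.
  have /nbhs_ballP[r /= r0 rU] : nbhs x U by exact: open_nbhs_nbhs.
  have [n nr] : exists n, (n.+1%:R^-1 < r / 2 :> R)%R.
    have r20 : (0 < r / 2)%R by rewrite divr_gt0.
    have [n _ /(_ n (leqnn n))] := near_infty_natSinv_lt (PosNum r20).
    by exists n.
  have [a] : exists a : rat, (ratr a \in `]x.1 - n.+1%:R^-1, x.1 + n.+1%:R^-1[)%R.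
    by apply: rat_in_itvoo; rewrite ltrBlDr -addrA ltrDl addr_gt0.
  have [b] : exists b : rat, (ratr b \in `]x.2 - n.+1%:R^-1, x.2 + n.+1%:R^-1[)%R.
    by apply: rat_in_itvoo; rewrite ltrBlDr -addrA ltrDl addr_gt0.
  rewrite !in_itv/= => /andP[b1 b2] /andP[a1 a2].
  exists (a, b, n).
    move=> y [] /=; rewrite !in_itv/= => /andP[y1 y2] /andP[y3 y4].
    have close (s t c i : R) : (i < r / 2 -> s - i < c -> c < s + i -> c - i < t ->
        t < c + i -> `|s - t| < r)%R by rewrite ltr_norml => *; lra.
    by apply: rU; split; [exact: (close _ _ (ratr a) _ nr)|
      exact: (close _ _ (ratr b) _ nr)].
  split; rewrite /= in_itv/= ltrBlDr.
    by rewrite a2/= -ltrBlDr a1.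
  by rewrite b2/= -ltrBlDr b1.
rewrite bigcup_mkcond; apply: countable_bigcupT_measurable => // p.
by case: ifP => // _; exact: measurableX.
Qed.

Notation T1 := (measurableTypeR R).
Notation T2 := (T1 * T1)%type.
Lemma lsc_on_measurable (P : set T2) (f : T2 -> \bar R) :
  measurable P -> lsc_on P f -> measurable_fun P f.
Proof.
move=> mP lf; apply: (measurability _ (ErealGenOInfty.measurableE R)).
move=> /= _ [_ [a ->]] <-; rewrite preimage_itvoy.
pose U := [set V | open V /\ forall y, V y -> P y -> a%:E < f y].
have -> : P `&` [set x | a%:E < f x] = P `&` \bigcup_(V in U) V.
  apply/seteqP; split=> x [Px].
    move=> /= /(lf _ Px)[V]; rewrite nbhsE => -[W [oW Wx] WV] Vf.
    by split => //; exists W => //; split => // y /WV; exact: Vf.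
  by move=> [V [_ Vf] Vx]; split=> //=; exact: Vf.
apply: measurableI => //; apply: open_measurable_prod.
by apply: bigcup_open => V [].
Qed.

Lemma expeR_lsc (P : set T2) (f : T2 -> \bar R) :
  lsc_on P f -> lsc_on P (fun x => expeR (f x)).
Proof.
move=> lf x Px a; have [a0|a0] := ltP a 0%R.
  move=> _; exists setT; first exact: filterT.
  by move=> y _ _; rewrite (lt_le_trans _ (expeR_ge0 _))// lte_fin.
have [->|an0] := eqVneq a 0%R.
  have [->|fx _] := eqVneq (f x) -oo; first by rewrite ltxx.
  have [r rf] : exists r : R, r%:E < f x.
    by case: (f x) fx => // [r|] _; [exists (r - 1)%R; rewrite lte_fin; lra|exists 0%R; rewrite ltry].
  have [V Vx Vf] := lf x Px r rf; exists V => // y Vy Py.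
  by apply: expeR_gt0; rewrite (le_lt_trans _ (Vf _ Vy Py))// leNye.
have {an0}a0 : (0 < a)%R by rewrite lt_neqAle eq_sym an0.
have aE : a%:E = expeR (ln a)%:E by rewrite /= lnK.
rewrite aE lte_expeR => /(lf _ Px)[V Vx Vf]; exists V => // y Vy Py.
by rewrite lte_expeR; exact: Vf.
Qed.

Lemma affine_measurable (a b : R) : measurable_fun setT (fun t : T1 => (a * t + b)%R : T1).
Proof. by apply: measurable_funD => //; exact: measurable_funM. Qed.

(** By uniqueness of Lebesgue measure it suffices to compare on half-open intervals. A negative [a]
    reverses them, so the closed end changes side, which does not affect the length. *)
Lemma lebesgue_measure_affine (a b : R) (A : set T1) : a != 0%R -> measurable A ->
  mu A = (`|a|)%:E * mu ((fun t : R => (a * t + b)%R) @^-1` A).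
Proof.
move=> a0 mA; pose f : T1 -> T1 := fun t => (a * t + b)%R.
have mf : measurable_fun setT f by exact: affine_measurable.
pose nu : {measure set T1 -> \bar R} :=
  measure_function_pushforward__canonical__measure_function_Measure mu mf.
have na : (0 <= `|a|)%R by [].
apply: (@lebesgue_measure_unique R (mscale (NngNum na) nu)) => //= _ [[x y]] _ <-.
rewrite /mscale -[X in _ * X]/(mu (f @^-1` _)) /=.
have [ap|an] := ltP 0%R a.
  have -> : f @^-1` `]x, y]%classic = `]((x - b) / a)%R, ((y - b) / a)%R]%classic.
    by apply/seteqP; split=> t; rewrite /f /= !in_itv/= ltr_pdivrMr// ler_pdivlMr//
      ltrBlDr lerBrDr mulrC.
  rewrite !lebesgue_measure_itv/= !lte_fin ltr_pM2r ?invr_gt0// ltrD2r.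
  case: ifPn => _; last by rewrite mule0.
  by rewrite -!EFinB -EFinM gtr0_norm//; congr EFin; field.
have {}an : (a < 0)%R by rewrite lt_neqAle a0.
have -> : f @^-1` `]x, y]%classic = `[((y - b) / a)%R, ((x - b) / a)%R[%classic.
  by apply/seteqP; split=> t; rewrite /f /= !in_itv/= ltr_ndivlMr// ler_ndivrMr//
    ltrBlDr lerBrDr mulrC andbC.
rewrite !lebesgue_measure_itv/= !lte_fin ltr_nM2r ?invr_lt0// ltrD2r.
case: ifPn => _; last by rewrite mule0.
by rewrite -!EFinB -EFinM ltr0_norm//; congr EFin; field.
Qed.

Lemma ge0_integral_affine (a b : R) (g : T1 -> \bar R) : a != 0%R ->
  measurable_fun setT g -> (forall t, 0 <= g t) ->
  \int[mu]_t g t = (`|a|)%:E * \int[mu]_t g (a * t + b)%R.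
Proof.
move=> a0 mg g0; pose f : T1 -> T1 := fun t => (a * t + b)%R.
have mf : measurable_fun setT f by exact: affine_measurable.
pose nu : {measure set T1 -> \bar R} :=
  measure_function_pushforward__canonical__measure_function_Measure mu mf.
have na : (0 <= `|a|)%R by [].
rewrite (@eq_measure_integral _ _ _ _ (mscale (NngNum na) nu)).
  rewrite ge0_integral_mscale//=; congr (_ * _).
  by rewrite (ge0_integral_pushforward mf)// preimage_setT.
by move=> A mA _; rewrite /mscale/= (lebesgue_measure_affine b a0 mA).
Qed.

(** The shear [(x, y) -> (x, y + a x)] preserves area: translate the inner integral, then exchange
    the order. With [a = w.2 / w.1] the inner integral runs along a line of direction [w]. *)
Lemma leb2_shear (a : R) (F : T2 -> \bar R) : measurable_fun setT F -> (forall x, 0 <= F x) ->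
  \int[@leb2 R]_z F z = \int[mu]_y \int[mu]_x F (x, (y + a * x)%R).
Proof.
move=> mF F0; rewrite /leb2 fubini_tonelli1//.
transitivity (\int[mu]_x \int[mu]_y F (x, (y + a * x)%R)).
  apply: eq_integral => x _; rewrite /fubini_F.
  have := @ge0_integral_affine 1%R (a * x)%R (fun y => F (x, y)) (oner_neq0 _).
  rewrite normr1 mul1e => ->//; last exact: measurableT_comp.
  by under eq_integral do rewrite mul1r.
pose F' (z : T2) := F (z.1, (z.2 + a * z.1)%R).
have mF' : measurable_fun setT F'.
  apply: measurableT_comp => //; apply: measurable_fun_pair => //=.
  apply: measurable_funD => //; apply: measurable_funM => //.
exact: (fubini_tonelli F' mF' (fun x => F0 _)).
Qed.

End plane_measure.

(** * Integration along lines *)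

Section slab_estimate.
Variable R : realType.
Local Open Scope ereal_scope.
Notation mu := (@lebesgue_measure R).
Notation T1 := (measurableTypeR R).
Notation T2 := (T1 * T1)%type.
Variables (m : nat) (v : 'I_m -> R * R).
Hypothesis vP : ccw_convex_polygon v.
Let P : set T2 := polygon v.

Lemma pair_affine_measurable (a b c d : R) :
  measurable_fun setT (fun t : T1 => ((a * t + b)%R, (c * t + d)%R) : T2).
Proof. by apply: measurable_fun_pair => /=; exact: affine_measurable. Qed.

Lemma polygon_measurable : measurable P.
Proof.
have -> : P = \bigcap_(i in [set: 'I_m]) [set x | (0 <= hgt v i x)%R].
  by apply/seteqP; split=> x Px i => [_|]; exact: Px.
apply: fin_bigcap_measurable => // i _.
have mh : measurable_fun setT (hgt v i : T2 -> T1).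
  rewrite /hgt /cross /psub/=; apply: measurable_funB; apply: measurable_funM => //=;
  by apply: measurable_funB.
rewrite -[X in measurable X]setTI.
have -> : [set x | (0 <= hgt v i x)%R] = hgt v i @^-1` `[0%R, +oo[%classic.
  by apply/seteqP; split=> x /=; rewrite in_itv/= andbT.
exact: mh.
Qed.

Lemma edge_measurable (f : T2 -> \bar R) i : measurable_fun P f ->
  measurable_fun (`[0%R, 1%R]%classic : set T1) (fun t : T1 => f (edge_pt v i t)).
Proof.
move=> mf; apply: (measurable_comp (F := P)) => //; first exact: polygon_measurable.
  by move=> _ [t /= t01 <-]; apply: polygon_edge => //; rewrite in_itv in t01.
apply: measurable_funTS.
have := pair_affine_measurable (psub (v (ordS i)) (v i)).1 (v i).1
  (psub (v (ordS i)) (v i)).2 (v i).2.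
by congr measurable_fun; apply/funext => t; rewrite /edge_pt /padd /pscale/=;
  congr pair; ring.
Qed.

Section slab.
Variables (w : R * R) (e : R) (D : T2 -> \bar R).
Hypotheses (w0 : w.1 != 0%R) (e0 : (0 < e)%R).
Hypotheses (mD : measurable_fun P D) (D0 : forall x, P x -> 0 <= D x).
Hypothesis D_le : forall x s, P x -> (0 <= s)%R -> P (ray x w s) -> D (ray x w s) <= D x.
Hypothesis D_deep : forall x, P x -> P (ray x w (- e)) -> D x = 0.

Let a := (w.2 / w.1)%R.
Let F := D \_ P.
Let pt (y x : R) : R * R := (x, (y + a * x)%R).
Let k (i : 'I_m) := (slope v i w / w.1)%R.
Let b (i : 'I_m) := ((v i).2 - a * (v i).1)%R.
Let H (i : 'I_m) : T1 -> \bar R := (fun t : T1 => D (edge_pt v i t)) \_ `[0%R, 1%R].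
(** The line with intercept [y] meets the line of edge [i] at the parameter [(b i - y) / k i], so
    [g i y] is the slice bound for a line entering through edge [i]. It is set to 0 for edges
    parallel to [w], through which no line enters. *)
Let g (i : 'I_m) (y : T1) : \bar R := if slope v i w == 0%R then 0 else
  (e * `|w.1|)%:E * H i (- (k i)^-1 * y + b i / k i)%R.

Let F0 x : 0 <= F x.
Proof. by rewrite /F patchE; case: ifPn => // /set_mem; exact: D0. Qed.

Let H0 i t : 0 <= H i t.
Proof.
rewrite /H patchE; case: ifPn => // /set_mem /= t01.
by apply: D0; apply: polygon_edge => //; rewrite in_itv in t01.
Qed.

Let mF : measurable_fun setT F.
Proof. by apply/(measurable_restrictT _ _).1 => //; exact: polygon_measurable. Qed.

Let mH i : measurable_fun setT (H i).
Proof. by apply/(measurable_restrictT _ _).1 => //; exact: edge_measurable. Qed.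

Let mg i : measurable_fun setT (g i).
Proof.
rewrite /g; have [_|_] := eqVneq (slope v i w) 0%R; first exact: (@measurable_cst _ _ T1 (\bar R) setT 0).
exact: (measurable_funeM _ (measurableT_comp (mH i) (affine_measurable (- (k i)^-1) (b i / k i)))).
Qed.

Let g0 i y : 0 <= g i y.
Proof.
by rewrite /g; have [_|_] := eqVneq (slope v i w) 0%R; rewrite // mule_ge0// lee_fin mulr_ge0// ltW.
Qed.

Let ray_pt y x s : ray (pt y x) w s = pt y (x + s * w.1).
Proof. by rewrite /ray /pt /a /padd /pscale/=; congr pair; field. Qed.

Let mpt y : measurable_fun setT (pt y : T1 -> T2).
Proof.
have := pair_affine_measurable 1 0 a y.
by congr measurable_fun; apply/funext => t; rewrite /pt; congr pair; ring.
Qed.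

(** The edge of entrance varies with [y]; summing the nonnegative [g i y] over all edges avoids
    choosing it measurably. *)
Let slice_le y : \int[mu]_x F (pt y x) <= \sum_(i < m) g i y.
Proof.
have [[x0 Fx0]|/forallNP F_eq0] := pselect (exists x0, F (pt y x0) != 0); last first.
  rewrite integral0_eq.
    by apply: sume_ge0 => i _; exact: g0.
  by move=> x _; apply/eqP; apply: contrapT => /negP; exact: F_eq0.
have suppF x : F (pt y x) != 0 -> P (pt y x) /\ D (pt y x) != 0.
  by rewrite /F patchE; case: ifPn => [/set_mem//|]; rewrite eqxx.
have [Px0 _] := suppF _ Fx0.
(* Following [- w] from a point of the support leads to the entrance point [pt y z] on an edge whose
   slope along [w] is positive. *)
have nw0 : pscale (-1) w != (0%R, 0%R).
  by rewrite /pscale xpair_eqE/= mulN1r oppr_eq0 (negbTE w0).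
have [i1 si1] := slope_neg vP nw0.
have [|s [i [s0 sA si hi]]] := @exit_time _ _ (fun i => hgt v i (pt y x0))
  (fun i => slope v i (pscale (-1) w)) i1 _ si1; first by move=> i; exact: Px0.
have sN j : slope v j (pscale (-1) w) = (- slope v j w)%R.
  by rewrite /slope /cross /pscale/=; ring.
move: si hi; rewrite sN => si hi.
pose z := (x0 - s * w.1)%R.
have hz j : hgt v j (pt y z) = (hgt v j (pt y x0) + s * slope v j (pscale (-1) w))%R.
  by rewrite /z -mulNr -ray_pt hgt_ray sN; ring.
have Pz : P (pt y z) by move=> j; rewrite -/(hgt v j _) hz.
have [t t01 zt] : exists2 t, (0 <= t <= 1)%R & pt y z = edge_pt v i t.
  by apply: boundary_edge => //; rewrite hz sN.
(* The interval with ends [z] and [z + e * w.1], written by its centre so that both signs of [w.1]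
   are covered. *)
pose I : set T1 := `[(z + e * w.1 / 2 - e * `|w.1| / 2)%R, (z + e * w.1 / 2 + e * `|w.1| / 2)%R]%classic.
have mI : measurable I by exact: measurable_itv.
have w1 : (0 < `|w.1|)%R by rewrite normr_gt0.
apply: (@le_trans _ _ (\int[mu]_x ((cst (D (pt y z))) \_ I) x)).
  apply: ge0_le_integral => //.
  - exact: (measurableT_comp mF (mpt y)).
  - exact: ((measurable_restrictT _ mI).1 (@measurable_cst _ _ T1 (\bar R) I (D (pt y z)))).
  move=> x _; have [->|Fx] := eqVneq (F (pt y x)) 0.
    by rewrite patchE; case: ifPn => // _; exact: D0.
  have [Px Dx] := suppF _ Fx.
  pose r := ((x - z) / w.1)%R.
  have xE : pt y x = ray (pt y z) w r by rewrite ray_pt /r divfK// addrC subrK.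
  have r0 : (0 <= r)%R.
    have := Px i; rewrite -/(hgt v i _) xE hgt_ray hz sN hi add0r.
    by rewrite pmulr_lge0//; move: si; rewrite oppr_lt0.
  (* Beyond depth [e], stepping back by [e w] lands between the entrance point and [x], hence in
     [P], and [D_deep] applies. Each height is compared with the one at the entrance if it increases
     along [w], with the one at [x] otherwise. *)
  have re : (r <= e)%R.
    rewrite leNgt; apply/negP => er; move/eqP: Dx; apply; apply: D_deep => //.
    move=> j; rewrite -/(hgt v j _) xE ray_ray hgt_ray.
    have := Px j; rewrite -/(hgt v j _) xE hgt_ray => h1.
    have h2 : (0 <= hgt v j (pt y z))%R := Pz j.
    have [sj|sj] := leP 0%R (slope v j w).
      by rewrite addr_ge0// mulr_ge0// subr_ge0 ltW.
    apply: (le_trans h1); rewrite lerD2l ler_wnM2r ?(ltW sj)//.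
    by rewrite gerBl ltW.
  rewrite patchE mem_set/=.
    by rewrite /F patchE mem_set// xE; apply: D_le => //; rewrite -xE.
  rewrite /I/= in_itv/=.
  have -> : x = (z + r * w.1)%R by rewrite /r divfK// addrC subrK.
  have : (`|(r - e / 2) * w.1| <= e / 2 * `|w.1|)%R.
    by rewrite normrM ler_wpM2r// ler_norml; apply/andP; split; lra.
  by rewrite ler_norml => /andP[h1 h2]; apply/andP; split; lra.
have muI : lebesgue_measure I = (e * `|w.1|)%:E.
  rewrite /I lebesgue_measure_itv/= lte_fin.
  have -> : (z + e * w.1 / 2 - e * `|w.1| / 2 < z + e * w.1 / 2 + e * `|w.1| / 2)%R.
    have : (0 < e * `|w.1|)%R by rewrite mulr_gt0.
    lra.
  by rewrite -EFinB; congr EFin; lra.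
rewrite -integral_mkcond integral_cst; last exact: mI.
rewrite -[X in _ * X]/(lebesgue_measure I) muI.
rewrite muleC; apply: (@le_trans _ _ (g i y)); last first.
  by rewrite (bigD1 i)//= leeDl// sume_ge0.
have sw : slope v i w != 0%R by move: si; rewrite oppr_lt0 => /gt_eqF ->.
rewrite /g (negbTE sw) zt.
have -> : (- (k i)^-1 * y + b i / k i)%R = t.
  have yE : (y = (edge_pt v i t).2 - a * (edge_pt v i t).1)%R by rewrite -zt /pt/=; ring.
  rewrite yE /b.
  have kE : k i = (((v (ordS i)).1 - (v i).1) * a - ((v (ordS i)).2 - (v i).2))%R.
    by rewrite /k /a /slope /cross /psub/=; field.
  have k0 : k i != 0%R by rewrite /k mulf_neq0// invr_eq0.
  apply: (mulfI k0); rewrite mulrDr mulrA mulrN divff// mulN1r mulrCA divff// mulr1.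
  by rewrite kE /edge_pt /padd /pscale /psub/=; ring.
by rewrite /H patchE mem_set//= in_itv.
Qed.

(* Each line of direction [w] meets the support of [D] in length at most [e * |w|],
and there [D] is bounded by its value at the entrance point, which lies on an edge. *)
Lemma slab_bound : \int[@leb2 R]_(x in P) D x <=
  \sum_(i < m) (e * `|slope v i w|)%:E * \int[mu]_(t in `[0%R, 1%R]) D (edge_pt v i t).
Proof.
rewrite integral_mkcond (@leb2_shear R a F)//.
apply: (@le_trans _ _ (\int[mu]_y \sum_(i < m) g i y)).
  apply: ge0_le_integral => //.
  - by move=> y _; exact: integral_ge0.
  - pose F' (z : T2) := F (z.2, (z.1 + a * z.2)%R).
    apply: (measurable_fun_fubini_tonelli_F F'); last by move=> z; exact: F0.
    apply: measurableT_comp => //; apply: measurable_fun_pair => //=.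
    by apply: measurable_funD => //; exact: measurable_funM.
  - exact: emeasurable_sum.
  - by move=> y _; exact: slice_le.
rewrite ge0_integral_sum//; apply: lee_sum => i _; rewrite /g.
have [s0|s0] := eqVneq (slope v i w) 0%R.
  by rewrite integral0 s0 normr0 mulr0 mul0e.
have k0 : k i != 0%R by rewrite /k mulf_neq0// invr_eq0.
rewrite ge0_integralZl//; last 2 first.
- exact: (measurableT_comp (mH i) (affine_measurable (- (k i)^-1) (b i / k i))).
- by rewrite lee_fin mulr_ge0// ltW.
rewrite [X in _ <= _ * X]integral_mkcond -/(H i).
have nk : (- (k i)^-1 != 0)%R by rewrite oppr_eq0 invr_eq0.
(* The substitution contributes [|k i|], and [|w.1| * |k i| = |slope v i w|]. *)
rewrite (@ge0_integral_affine R (- (k i)^-1) (b i / k i) (H i))// muleA -EFinM.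
rewrite le_eqVlt; apply/orP; left; apply/eqP; congr (_%:E * _).
by rewrite normrN normfV /k normrM normfV; field; rewrite !normr_eq0 w0 s0.
Qed.

End slab.
End slab_estimate.

(** * Directional inf-convolution *)

Section inf_convolution.
Variable R : realType.
Implicit Types x y z w : R * R.

Lemma ray_cvg x w (t : R) :
  (fun p : R * (R * R) => ray p.2 w p.1) @ nbhs (t, x) --> ray x w t.
Proof.
rewrite /ray /padd /pscale.
have h1 : (fun p : R * (R * R) => p.1) @ nbhs (t, x) --> t by exact: cvg_fst.
have h2 : (fun p : R * (R * R) => p.2) @ nbhs (t, x) --> x by exact: cvg_snd.
have h21 : (fun p : R * (R * R) => p.2.1) @ nbhs (t, x) --> x.1.
  by apply: (cvg_comp _ _ h2); exact: cvg_fst.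
have h22 : (fun p : R * (R * R) => p.2.2) @ nbhs (t, x) --> x.2.
  by apply: (cvg_comp _ _ h2); exact: cvg_snd.
apply: (@cvg_pair _ _ _ _ (nbhs (x.1 + t * w.1)) (nbhs (x.2 + t * w.2))).
- by apply: cvgD => //; apply: cvgM => //; exact: cvg_cst.
- by apply: cvgD => //; apply: cvgM => //; exact: cvg_cst.
Qed.

(** Joint in time and base point, as required by the compactness argument for lower
    semicontinuity. *)
Lemma ray_near x w (t : R) (V : set (R * R)) : nbhs (ray x w t) V ->
  \forall t' \near t & y \near x, V (ray y w t').
Proof. exact: ray_cvg. Qed.

Section polygon_topology.
Variables (m : nat) (v : 'I_m -> R * R).

Lemma hgt_continuous i : continuous (hgt v i).
Proof.
move=> x; rewrite /hgt /cross /psub/=.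
apply: cvgB; apply: cvgM; try exact: cvg_cst.
- by apply: cvgB; [exact: cvg_snd|exact: cvg_cst].
- by apply: cvgB; [exact: cvg_fst|exact: cvg_cst].
Qed.

Lemma polygon_closed : closed (polygon v).
Proof.
have -> : polygon v = \bigcap_(i in [set: 'I_m]) (hgt v i @^-1` [set t | 0 <= t]).
  by apply/seteqP; split=> x Px i => [_|]; exact: Px.
apply: closed_bigI => i _; apply: closed_comp; last exact: closed_ge.
by move=> x _; exact: hgt_continuous.
Qed.

Lemma polygon_compact : ccw_convex_polygon v -> compact (polygon v).
Proof.
move=> vP; have [L hL] := polygon_bounded vP.
have cI : compact (`[- L, L]%classic : set R) by exact: segment_compact.
apply: (subclosed_compact polygon_closed (compact_setX cI cI)).
by move=> x /hL[h1 h2]; split; rewrite /= in_itv/= -ler_norml.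
Qed.

End polygon_topology.

Section infconv.
Variables (m : nat) (v : 'I_m -> R * R).
Hypothesis vP : ccw_convex_polygon v.
Let P := polygon v.
Variable q : R * R -> \bar R.
Hypotheses (qNy : forall x, P x -> q x != -oo%E) (lq : lsc_on P q) (cq : convex_on P q).
Local Open Scope ereal_scope.

(** Each point has a neighbourhood on which [q] is bounded below; compactness makes the bound
    uniform. *)
Lemma lsc_lower_bound : exists M : R, forall x, P x -> M%:E <= q x.
Proof.
have := (compact_near_coveringP P).1 (polygon_compact vP).
move=> /(near_covering_withinP P) /(_ _ \oo%classic (fun n x => - n%:R%:E <= q x) _).
have c x : P x -> \forall x' \near x & n \near \oo%classic, P x' -> - n%:R%:E <= q x'.
  move=> Px; have [r rq] : exists r : R, r%:E < q x.
    have := qNy Px; case: (q x) => // [r|] _; first by exists (r - 1)%R; rewrite lte_fin; lra.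
    by exists 0%R; rewrite ltry.
  have [V Vx Vq] := lq Px rq.
  exists (V, [set n | (`|r| <= n%:R)%R]); first split => //=.
    by exists (Num.bound `|r|) => // n /= bn; apply: (le_trans (ltW (archi_boundP (normr_ge0 r)))); rewrite ler_nat.
  move=> [y n] /= [Vy rn] Py; apply: ltW; apply: le_lt_trans (Vq _ Vy Py).
  by rewrite lee_fin lerNl (le_trans _ rn)// -normrN ler_norm.
move=> /(_ c)[N _ /(_ N (leqnn N)) h].
by exists (- N%:R)%R => x Px; rewrite EFinN; exact: h.
Qed.

Variables (w : R * R) (k M : R).
Hypotheses (k0 : (0 < k)%R) (qM : forall x, P x -> M%:E <= q x).

(** On the polygon, the largest minorant of [q] that drops along [w] at rate at most [k]. Since [q]
    is arbitrary off the polygon, only times at which the ray is inside compete. *)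
Definition infconv x : \bar R := ereal_inf
  [set q (ray x w t) + (k * t)%:E | t in [set t | (0 <= t)%R /\ P (ray x w t)]].
Let qt := infconv.

Lemma infconv_ray_le x t : (0 <= t)%R -> P (ray x w t) -> qt x <= q (ray x w t) + (k * t)%:E.
Proof. by move=> t0 Pt; apply: ereal_inf_lbound; exists t. Qed.

Lemma infconv_le x : P x -> qt x <= q x.
Proof.
move=> Px; have := @infconv_ray_le x 0%R (lexx _).
by rewrite ray0 mulr0 adde0; exact.
Qed.

Lemma infconv_ltP x (A : \bar R) : qt x < A ->
  exists t, [/\ (0 <= t)%R, P (ray x w t) & q (ray x w t) + (k * t)%:E < A].
Proof. by move=> /ereal_inf_lt[_ [t [t0 Pt] <-] tA]; exists t. Qed.

Lemma infconv_ge x : M%:E <= qt x.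
Proof.
apply: le_ereal_inf_tmp => _ [t [t0 Pt] <-].
by rewrite -[leLHS]adde0 leeD ?qM// lee_fin mulr_ge0// ltW.
Qed.

Lemma infconv_neqNy x : qt x != -oo.
Proof. by rewrite gt_eqF// (lt_le_trans _ (infconv_ge x))// ltNyr. Qed.

Lemma infconv_lipschitz x s : (0 <= s)%R -> qt x <= qt (ray x w s) + (k * s)%:E.
Proof.
move=> s0; rewrite -leeBlDr//; apply: le_ereal_inf_tmp => _ [t [t0 Pt] <-].
rewrite ray_ray in Pt *; rewrite leeBlDr//.
apply: (le_trans (infconv_ray_le (addr_ge0 s0 t0) Pt)).
by rewrite -addeA -EFinD leeD// lee_fin; lra.
Qed.

Lemma infconv_convex : convex_on P qt.
Proof.
move=> x y Px Py t /andP[t0 t1].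
have t1' : (0 < 1 - t)%R by rewrite subr_gt0.
have := infconv_neqNy x; case Ex : (qt x) => [X| |] // _; last first.
  rewrite gt0_muley ?lte_fin// addye ?leey//.
  have := infconv_neqNy y; rewrite -/qt; case: (qt y) => // _; by rewrite gt0_muley ?lte_fin.
have := infconv_neqNy y; case Ey : (qt y) => [Y| |] // _; last first.
  by rewrite gt0_muley ?lte_fin// -EFinM addey ?leey.
rewrite -!EFinM -EFinD; apply/lee_addgt0Pr => e e0.
have [s [s0 Ps sX]] : exists s, [/\ (0 <= s)%R, P (ray x w s) & q (ray x w s) + (k * s)%:E < (X + e)%:E].
  by apply: infconv_ltP; rewrite Ex lte_fin ltrDl.
have [r [r0 Pr rY]] : exists s, [/\ (0 <= s)%R, P (ray y w s) & q (ray y w s) + (k * s)%:E < (Y + e)%:E].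
  by apply: infconv_ltP; rewrite Ey lte_fin ltrDl.
have t01 : (0 <= t <= 1)%R by rewrite !ltW.
have sr0 : (0 <= t * s + (1 - t) * r)%R by rewrite addr_ge0// mulr_ge0// ltW.
have zE : padd (pscale t (ray x w s)) (pscale (1 - t) (ray y w r)) =
    ray (padd (pscale t x) (pscale (1 - t) y)) w (t * s + (1 - t) * r).
  by rewrite /ray /padd /pscale/=; congr pair; ring.
apply: (le_trans (infconv_ray_le sr0 _)); first by rewrite -zE; exact: polygon_conv.
rewrite -zE -leeBrDr//.
have h1 : q (ray x w s) <= (X + e - k * s)%:E by rewrite EFinB leeBrDr// ltW.
have h2 : q (ray y w r) <= (Y + e - k * r)%:E by rewrite EFinB leeBrDr// ltW.
apply: (le_trans (convex_on_ub cq Ps Pr t01 h1 h2)).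
by rewrite lee_fin; lra.
Qed.

(** Only a compact range of times matters, and on it the strict lower bound persists uniformly for
    base points near [x]. *)
Lemma infconv_lsc : lsc_on P qt.
Proof.
move=> x Px a ax.
(* The intermediate level [a'] absorbs the loss of strictness in passing to the infimum. *)
have [a' aa' a'x] : exists2 a' : R, (a < a')%R & a'%:E < qt x.
  move: ax; have := infconv_neqNy x; case: (qt x) => // [X| ] _.
    by rewrite lte_fin => aX; exists ((a + X) / 2)%R; rewrite ?lte_fin; lra.
  by move=> _; exists (a + 1)%R; rewrite ?ltry//; lra.
(* For [t > T] the bound [M + k t >= a'] alone suffices. *)
pose T := Num.max 0%R ((a' - M) / k)%R.
have := (compact_near_coveringP _).1 (@segment_compact R 0%R T).
move=> /(_ _ (nbhs x) (fun y t => P (ray y w t) -> a'%:E < q (ray y w t) + (k * t)%:E) _).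
have c t : `[0%R, T]%classic t -> \forall t' \near t & y \near x,
    P (ray y w t') -> a'%:E < q (ray y w t') + (k * t')%:E.
  rewrite /= in_itv/= => /andP[t0 tT].
  have [Pt|Pt] := pselect (P (ray x w t)); last first.
    have oP : nbhs (ray x w t) (~` P).
      by apply: open_nbhs_nbhs; split=> //; apply: closed_openC; exact: polygon_closed.
    by apply: filterS (ray_near oP) => -[t' y] /= nP /nP.
  have := lt_le_trans a'x (infconv_ray_le t0 Pt).
  rewrite -lteBlDr// -EFinB => ht.
  have [a1 ta1 a1q] : exists2 a1 : R, (a' - k * t < a1)%R & a1%:E < q (ray x w t).
    move: ht; have := qNy Pt; case: (q _) => // [X| ] _.
      by rewrite lte_fin => aX; exists ((a' - k * t + X) / 2)%R; rewrite ?lte_fin; lra.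
    by move=> _; exists (a' - k * t + 1)%R; rewrite ?ltry//; lra.
  have [V Vx Vq] := lq Pt a1q.
  have hV := ray_near Vx.
  have hk : \forall t' \near t & y \near x, (a' - k * t' < a1)%R.
    have : (fun p : R * (R * R) => (a' - k * p.1)%R) @ nbhs (t, x) --> (a' - k * t)%R.
      apply: cvgB; first exact: cvg_cst.
      by apply: cvgM; [exact: cvg_cst|exact: cvg_fst].
    by move=> /(_ _ (lt_nbhsl ta1)).
  apply: filterS2 hk hV => -[t' y] /= h1 Vy Py.
  rewrite -lteBlDr// -EFinB; apply: le_lt_trans (Vq _ Vy Py).
  by rewrite lee_fin ltW.
move=> /(_ c) h; exists [set y | `[0%R, T] `<=` (fun t => P (ray y w t) -> a'%:E < q (ray y w t) + (k * t)%:E)] => //.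
move=> y hy _; apply: (@lt_le_trans _ _ a'%:E); first by rewrite lte_fin.
apply: le_ereal_inf_tmp => _ [t [t0 Pt] <-].
have [tT|tT] := leP t T; first by apply/ltW/hy => //; rewrite /= in_itv/= t0.
rewrite (le_trans _ (leeD (qM Pt) (lexx _)))// -EFinD lee_fin.
have : ((a' - M) / k <= t)%R by rewrite (le_trans _ (ltW tT))// le_max lexx orbT.
by rewrite ler_pdivrMr//; lra.
Qed.

(** A smaller value at some [t] means that [q] drops from [x] to [x + t w] at a rate above [k]. By
    convexity it drops at least as fast on the preceding segment of length [e], against
    [B - M < k e]. *)
Lemma infconv_eq x e B : P x -> (0 < e)%R -> P (ray x w (- e)) ->
  q (ray x w (- e)) <= B%:E -> (B - M < k * e)%R -> qt x = q x.
Proof.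
move=> Px e0 Pe qB ke; apply/eqP; rewrite eq_le infconv_le//= leNgt; apply/negP => lt.
have [t [t0 Pt]] := infconv_ltP lt.
have := qM Pt; case Et : (q (ray x w t)) => [C| |] //; last first.
  by rewrite addye// => _; rewrite ltNge leey.
rewrite lee_fin -EFinD => MC Cx.
have xE : x = ray (ray x w (- e)) w e by rewrite ray_ray addNr ray0.
have tE : ray x w t = ray (ray x w (- e)) w (e + t) by rewrite {1}xE ray_ray.
have et0 : (0 < e + t)%R by rewrite ltr_pwDl.
have ett : (0 <= e <= e + t)%R by rewrite (ltW e0) lerDl.
have Pt' : P (ray (ray x w (- e)) w (e + t)) by rewrite -tE.
have qC : q (ray (ray x w (- e)) w (e + t)) <= C%:E by rewrite -tE Et.
have := convex_on_ray cq Pe Pt' et0 ett qB qC.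
rewrite -xE => /(lt_le_trans Cx); rewrite lte_fin => h.
have : ((e + t) * (C + k * t) < (e + t) * B + e * (C - B))%R.
  have -> : ((e + t) * B + e * (C - B) = (e + t) * (B + e / (e + t) * (C - B)))%R.
    by field; rewrite gt_eqF.
  by rewrite ltr_pM2l.
have : (0 <= t * (k * e - (B - C)))%R by rewrite mulr_ge0//; lra.
have : (0 <= k * t * t)%R by rewrite !mulr_ge0// ltW.
lra.
Qed.

(** Where [qt < q], the function [q] drops further on at a mean rate above [k], so by convexity its
    mean rate before that point is at least [k]. *)
Lemma infconv_steep x s : P x -> (0 <= s)%R -> P (ray x w s) ->
  qt (ray x w s) < q (ray x w s) -> q (ray x w s) + (k * s)%:E <= q x.
Proof.
move=> Px; rewrite le_eqVlt => /predU1P[<-|s0] Ps; first by rewrite ray0 mulr0 adde0.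
move=> /infconv_ltP[t [t0 Pt]]; rewrite ray_ray in Pt *.
have := qM Pt; case Et : (q (ray x w (s + t))) => [C| |] // _; last by rewrite addye// ltNge leey.
rewrite -EFinD => Cs.
have := qM Px; case Ex : (q x) => [A| |] // _; last by rewrite leey.
have st0 : (0 < s + t)%R by rewrite ltr_pwDl.
have stt : (0 <= s <= s + t)%R by rewrite (ltW s0) lerDl.
have qA : q x <= A%:E by rewrite Ex.
have qC : q (ray x w (s + t)) <= C%:E by rewrite Et.
have := convex_on_ray cq Px Pt st0 stt qA qC.
move: Cs; have := qM Ps; case: (q (ray x w s)) => [Y| |] // _.
rewrite lte_fin !lee_fin => CY YA.
have h : ((s + t) * Y <= (s + t) * A + s * (C - A))%R.
  have -> : ((s + t) * A + s * (C - A) = (s + t) * (A + s / (s + t) * (C - A)))%R.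
    by field; rewrite gt_eqF.
  by rewrite ler_pM2l.
have h2 : (s * (C + k * t) < s * Y)%R by rewrite ltr_pM2l.
have tp : (0 < t)%R.
  rewrite lt_neqAle t0 andbT eq_sym; apply/eqP => t0'.
  by move: h CY h2; rewrite t0' !addr0 !mulr0 addr0; lra.
have : (t * (Y + k * s) < t * A)%R by lra.
by rewrite ltr_pM2l// => /ltW.
Qed.

(** Truncation at 0 settles [+oo - +oo], which evaluates to [-oo]; the decomposition [defectE] then
    holds also where both terms are infinite. *)
Definition defect x : \bar R := maxe 0 (expeR (q x) - expeR (qt x)).

Lemma defect_ge0 x : 0 <= defect x.
Proof. by rewrite /defect le_max lexx. Qed.

Lemma defectE x : P x -> expeR (q x) = expeR (qt x) + defect x.
Proof.
move=> Px; have := infconv_le Px; rewrite -/qt /defect.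
rewrite -lee_expeR.
have := expeR_ge0 (qt x); have := expeR_ge0 (q x).
case: (expeR (q x)) => [a| |] //; case: (expeR (qt x)) => [b| |] //=.
- rewrite !lee_fin => _ _ ba; rewrite max_r; first by congr EFin; ring.
  by rewrite lee_fin subr_ge0.
- by move=> _ _ _; rewrite max_r ?leey.
Qed.

Lemma defect_eq0 x : qt x = q x -> defect x = 0.
Proof.
move=> E; rewrite /defect E max_l//.
case: (expeR (q x)) => [r| |]; [by rewrite subee|by rewrite /= leNye|by rewrite /= leNye].
Qed.

(** Going back by [s w] raises [q] by at least [k s] ([infconv_steep]) and [qt] by at most [k s]
    ([infconv_lipschitz]), so the difference of exponentials grows at least by the factor
    [exp (k s) >= 1]. *)
Lemma defect_ray_le x s : P x -> (0 <= s)%R -> P (ray x w s) ->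
  defect (ray x w s) <= defect x.
Proof.
move=> Px s0 Ps.
have := infconv_le Ps; rewrite le_eqVlt => /predU1P[E|lt].
  by rewrite (defect_eq0 E) defect_ge0.
have h1 := infconv_steep Px s0 Ps lt.
have h2 := @infconv_lipschitz x s s0.
rewrite /defect; move: lt h1 h2.
have := infconv_ge (ray x w s); have := infconv_ge x; rewrite -/qt.
have := qM Px.
case: (qt (ray x w s)) => [r| |] //; last by move=> _ _ _; rewrite ltNge leey.
case: (qt x) => [p| |] //.
case: (q x) => [A| |] //=; last by move=> *; rewrite [leRHS]max_r ?leey.
move=> _ _ _; case: (q _) => [B| |] //; rewrite -!EFinD ?lte_fin !lee_fin => rB BA pr.
rewrite /Order.max !lte_fin.
have E1 : (1 <= expR (k * s))%R by rewrite -expR0 ler_expR mulr_ge0// ltW.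
have E2 : (expR (B + k * s) <= expR A)%R by rewrite ler_expR.
have E3 : (expR p <= expR (r + k * s))%R by rewrite ler_expR.
have E4 : (expR r < expR B)%R by rewrite ltr_expR.
move: E2 E3; rewrite !expRD => E2 E3.
have E5 : (0 <= (expR B - expR r) * (expR (k * s) - 1))%R.
  by rewrite mulr_ge0// subr_ge0// ltW.
have h : (expR B - expR r <= expR A - expR p)%R by lra.
have h0 : (0 < expR B - expR r)%R by rewrite subr_gt0.
by rewrite h0 (lt_le_trans h0 h) lee_fin.
Qed.

End infconv.
End inf_convolution.

(** * Convex functions on a polygon *)

Section polygon_analysis.
Variable R : realType.
Notation mu := (@lebesgue_measure R).
Notation T1 := (measurableTypeR R).
Notation T2 := (T1 * T1)%type.
Variables (m : nat) (v : 'I_m -> R * R).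
Hypothesis vP : ccw_convex_polygon v.
Let P : set T2 := polygon v.
Let mP : measurable P. Proof. exact: polygon_measurable. Qed.
Local Open Scope ereal_scope.

(** The bound [d] is extended real: [d = +oo] excludes intervals on which an integrable function is
    infinite. *)
Lemma integral_itv_ge (f : T1 -> \bar R) (a b : R) (d : \bar R) :
  (0 <= a)%R -> (a < b)%R -> (b <= 1)%R ->
  measurable_fun (`[0%R, 1%R]%classic : set T1) f -> (forall t, (0 <= t <= 1)%R -> 0 <= f t) ->
  (forall t, (a <= t <= b)%R -> d <= f t) -> 0 <= d ->
  d * (b - a)%:E <= \int[mu]_(t in `[0%R, 1%R]) f t.
Proof.
move=> a0 ab b1 mf f0 df d0.
have sub : `[a, b]%classic `<=` `[0%R, 1%R]%classic.
  by move=> t /=; rewrite !in_itv/= => /andP[h1 h2]; rewrite (le_trans a0)//= (le_trans h2).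
have mab : measurable (`[a, b]%classic : set T1) by exact: measurable_itv.
have m01 : measurable (`[0%R, 1%R]%classic : set T1) by exact: measurable_itv.
apply: (@le_trans _ _ (\int[mu]_(t in `[a, b]) f t)); last first.
  by apply: ge0_subset_integral => // t /=; rewrite in_itv; exact: f0.
have muab : lebesgue_measure (`[a, b]%classic : set T1) = (b - a)%:E.
  by rewrite lebesgue_measure_itv/= lte_fin ab.
have -> : d * (b - a)%:E = \int[mu]_(t in `[a, b]) cst d t.
  by rewrite (integral_cst mu mab) -muab.
apply: ge0_le_integral => //.
- exact: measurable_funS mf.
Qed.

(** Integrability yields a point of finiteness on each side of [t], and convexity fills the gap
    between them. *)
Lemma convex_edge_finite (q : T2 -> \bar R) i : convex_on P q -> lsc_on P q ->
  \int[mu]_(t in `[0%R, 1%R]) expeR (q (edge_pt v i t)) < +oo ->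
  forall t, (0 < t < 1)%R -> q (edge_pt v i t) < +oo.
Proof.
move=> cq lq fin t0 /andP[t00 t01]; rewrite ltey; apply/negP => /eqP qt0.
have mu1 : measurable_fun (`[0%R, 1%R]%classic : set T1) (fun t : T1 => expeR (q (edge_pt v i t))).
  by apply: (edge_measurable vP (f := fun x => expeR (q x))); apply: lsc_on_measurable mP (expeR_lsc lq).
have no a b : (0 <= a)%R -> (a < b)%R -> (b <= 1)%R ->
    exists2 t, (a <= t <= b)%R & q (edge_pt v i t) < +oo.
  move=> a0 ab b1; apply: contrapT => /forall2NP h.
  move: fin; rewrite ltNge => /negP; apply.
  have := @integral_itv_ge (fun t => expeR (q (edge_pt v i t))) a b +oo a0 ab b1 mu1.
  rewrite gt0_mulye ?lte_fin ?subr_gt0//; apply => // [t _|t tab]; first exact: expeR_ge0.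
  by have [//|/negP] := h t; rewrite ltey negbK => /eqP ->.
have [a /andP[a0 at0] qa] := no 0%R t0 (lexx _) t00 (ltW t01).
have [b /andP[t0b b1] qb] := no t0 1%R (ltW t00) t01 (lexx _).
pose B := Num.max (fine (q (edge_pt v i a))) (fine (q (edge_pt v i b))).
have ub (x : \bar R) : x < +oo -> x <= (fine x)%:E by case: x => [r| |]; rewrite ?lexx ?ltxx ?leNye.
have : q (edge_pt v i t0) <= B%:E.
  apply: (convex_on_edge vP cq (a := a) (b := b)); rewrite ?a0 ?t0b//.
    by apply: (le_trans (ub _ qa)); rewrite lee_fin le_max lexx.
  by apply: (le_trans (ub _ qb)); rewrite lee_fin le_max lexx orbT.
by rewrite qt0 leye_eq.
Qed.

(** A point [y] near [x] is a convex combination [l z + (1 - l) x] with [z] still in the polygon and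
    [l] small but fixed, so [g y - g x <= l (B - g x)]. That [z] stays inside is where flat faces
    are used. *)
Lemma convex_polygon_usc (q : R * R -> \bar R) (g : R * R -> R) (B : R) :
  convex_on P q -> (forall x, P x -> q x = (g x)%:E) -> (forall x, P x -> (g x <= B)%R) ->
  forall (x : R * R) (e : R), P x -> (0 < e)%R -> \forall y \near x, P y -> (g y < g x + e)%R.
Proof.
move=> cq qg gB x e Px e0.
(* Chosen so that [l (B - g x) < e]; the final halving makes this strict and gives [l < 1]. *)
pose l := (e / (e + (B - g x)) / 2)%R.
have b0 : (0 <= B - g x)%R by rewrite subr_ge0 gB.
have eb : (0 < e + (B - g x))%R by rewrite ltr_wpDr.
have l0 : (0 < l)%R by rewrite !divr_gt0.
have l1 : (l < 1)%R.
  have : (e / (e + (B - g x)) <= 1)%R by rewrite ler_pdivrMr//; lra.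
  by rewrite /l; lra.
have lB : (l * (B - g x) < e)%R.
  have : ((e / (e + (B - g x))) * (B - g x) <= e)%R.
    by rewrite mulrAC ler_pdivrMr// ler_pM2l//; lra.
  rewrite /l; have : (0 <= (e / (e + (B - g x))) * (B - g x))%R by rewrite mulr_ge0// ltW// divr_gt0.
  by lra.
(* The height of [z = x + (y - x) / l]. A constraint tight at [x] passes from [y] to [z] by scaling;
   the others hold for [y] close to [x]. *)
have near_hgt i : \forall y \near x, P y -> (0 <= hgt v i x + (hgt v i y - hgt v i x) / l)%R.
  have := Px i; rewrite -/(hgt v i x) le_eqVlt => /predU1P[<-|hx].
    by apply: filterE => y Py; rewrite subr0 add0r divr_ge0// ?(ltW l0)//; exact: Py.
  have hl : ((1 - l) * hgt v i x < hgt v i x)%R by rewrite gtr_pMl// gtrBl.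
  have near_x : \forall y \near x, ((1 - l) * hgt v i x < hgt v i y)%R.
    exact: (@hgt_continuous _ _ v i x _ (lt_nbhsr hl)).
  apply: filterS near_x => y hy _.
  by rewrite -(pmulr_rge0 _ l0) mulrDr mulrCA divff ?gt_eqF// mulr1; lra.
apply: filterS (@filter_forall _ _ _ _ (nbhs_filter x) near_hgt) => y hy Py.
pose z := ray x (psub y x) l^-1.
have Pz : P z.
  move=> i; rewrite -/(hgt v i z) /z hgt_ray.
  have -> : slope v i (psub y x) = (hgt v i y - hgt v i x)%R.
    by rewrite /slope /hgt /cross /psub/=; ring.
  by rewrite mulrC; exact: hy.
have yE : y = padd (pscale l z) (pscale (1 - l) x).
  rewrite [LHS]surjective_pairing /z /ray /padd /pscale /psub/=.
  by congr pair; field; rewrite gt_eqF.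
have l01 : (0 <= l <= 1)%R by rewrite !ltW.
have h1 : q z <= B%:E by rewrite qg// lee_fin gB.
have h2 : q x <= (g x)%:E by rewrite qg.
have := convex_on_ub cq Pz Px l01 h1 h2; rewrite -yE qg// lee_fin => /le_lt_trans; apply.
by lra.
Qed.

Lemma convex_polygon_bounded_continuous (q : R * R -> \bar R) :
  (forall x, P x -> q x != -oo) -> lsc_on P q -> convex_on P q ->
  (forall i, q (v i) < +oo) -> bounded_continuous_on P q.
Proof.
move=> qNy lq cq qv.
have [M qM] := lsc_lower_bound vP qNy lq.
pose B := (\sum_i `|fine (q (v i))|)%R.
have qB x : P x -> q x <= B%:E.
  apply: (polygon_ub vP cq) => i.
  have := qv i; have := qNy _ (polygon_vertex vP i); rewrite /B (bigD1 i)//=.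
  case: (q (v i)) => // r _ _; rewrite lee_fin (le_trans (ler_norm _))// lerDl.
  exact: sumr_ge0.
pose g x := fine (q x).
have qg x : P x -> q x = (g x)%:E.
  by move=> Px; have := qM x Px; have := qB x Px; rewrite /g; case: (q x).
exists g; split=> //; split; last first.
  exists (`|B| + `|M|)%R => x Px; have := qM x Px; have := qB x Px; rewrite qg// !lee_fin => h1 h2.
  rewrite ler_norml; apply/andP; split.
    by have := ler_norm (- M)%R; rewrite normrN; have := normr_ge0 B; lra.
  by have := ler_norm B; have := normr_ge0 M; lra.
apply/subspace_continuousP => x Px.
apply/cvgrPdist_lt => e e0; rewrite near_withinE /=.
have gB y : P y -> (g y <= B)%R by move=> Py; rewrite -lee_fin -qg// qB.
have dist (r s d : R) : (s < r + d)%R -> (r - d < s)%R -> (`|r - s| < d)%R.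
  by move=> h1 h2; rewrite ltr_norml; apply/andP; split; lra.
have := convex_polygon_usc cq qg gB Px e0.
have xe : (g x - e)%:E < q x by rewrite qg// lte_fin; lra.
have [V Vx Vq] := lq x Px _ xe.
move: Vx; apply: filterS2 => y Vy h Py; have := Vq y Vy Py; rewrite qg// lte_fin => h1.
exact: dist (h Py) h1.
Qed.

Lemma leb2X (A B : set T1) : measurable A -> measurable B ->
  @leb2 R (A `*` B) = lebesgue_measure A * lebesgue_measure B.
Proof. by move=> mA mB; exact: (product_measure1E mu mu mA mB). Qed.

Lemma polygon_integral_gt0 (f : T2 -> \bar R) (d : R) : measurable_fun P f ->
  (0 < d)%R -> (forall x, P x -> d%:E <= f x) -> 0 < \int[@leb2 R]_(x in P) f x.
Proof.
move=> mf d0 df; have [c [r [r0 cr]]] := polygon_box vP.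
pose I (a : R) : set T1 := `[(a - r)%R, (a + r)%R]%classic.
have mI a : measurable (I a) by exact: measurable_itv.
have muI a : lebesgue_measure (I a) = (2 * r)%:E.
  rewrite /I lebesgue_measure_itv/= lte_fin (_ : (_ < _)%R); last by lra.
  by congr EFin; lra.
have sub : I c.1 `*` I c.2 `<=` P.
  rewrite /I => x [] /=; rewrite !in_itv/= => /andP[a1 a2] /andP[b1 b2].
  by apply: cr; rewrite ler_norml; apply/andP; split; lra.
apply: (@lt_le_trans _ _ (\int[@leb2 R]_(x in I c.1 `*` I c.2) f x)); last first.
  apply: ge0_subset_integral => //; first exact: measurableX.
  by move=> x Px; apply: le_trans (df x Px); rewrite lee_fin ltW.
apply: (@lt_le_trans _ _ (\int[@leb2 R]_(x in I c.1 `*` I c.2) cst d%:E x)); last first.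
  apply: ge0_le_integral => //.
  - exact: measurableX.
  - by move=> x _; rewrite lee_fin ltW.
  - exact: measurable_funS mf.
  - by move=> x /sub; exact: df.
rewrite integral_cst; last exact: measurableX.
rewrite -[X in _ * X]/(@leb2 R _) (leb2X (mI _) (mI _)) !muI -!EFinM lte_fin.
by rewrite !mulr_gt0.
Qed.

Lemma polygon_measure_lty : \int[@leb2 R]_(x in P) 1 < +oo.
Proof.
have [L hL] := polygon_bounded vP.
pose I : set T1 := `[(- L)%R, L]%classic.
have mI : measurable I by exact: measurable_itv.
have sub : P `<=` I `*` I.
  by move=> x /hL[h1 h2]; split; rewrite /I /= in_itv/= -ler_norml.
apply: (@le_lt_trans _ _ (\int[@leb2 R]_(x in I `*` I) (cst 1) x)).
  by apply: ge0_subset_integral => //; exact: measurableX.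
rewrite integral_cst; last exact: measurableX.
rewrite mul1e -[X in X < _]/(@leb2 R _) (leb2X mI mI) /I lebesgue_measure_itv/=.
by case: ifP => _; rewrite ?mule0 ?ltry// -EFinB -EFinM ltry.
Qed.

End polygon_analysis.

(** * The boundary measure *)

Section boundary_integral.
Variable R : realType.
Notation mu := (@lebesgue_measure R).
Notation T1 := (measurableTypeR R).
Notation T2 := (T1 * T1)%type.
Variables (m : nat) (v : 'I_m -> R * R) (c : R) (cs : 'I_m -> R).
Hypotheses (vP : ccw_convex_polygon v) (c0 : (0 < c)%R) (cs0 : forall i, (0 < cs i)%R).
Let P : set T2 := polygon v.
Let mP : measurable P. Proof. exact: polygon_measurable. Qed.
Local Open Scope ereal_scope.

Let wt i : R := (cs i * plen (psub (v (ordS i)) (v i)))%R.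
Let I (f : T2 -> \bar R) i := \int[mu]_(t in `[0%R, 1%R]) f (edge_pt v i t).

Lemma sigma_weight_gt0 i : (0 < cs i * plen (psub (v (ordS i)) (v i)))%R.
Proof.
rewrite mulr_gt0// sqrtr_gt0 lt_neqAle addr_ge0 ?sqr_ge0// andbT eq_sym.
rewrite paddr_eq0 ?sqr_ge0// !sqrf_eq0; apply/negP => /andP[/eqP e1 /eqP e2].
have := turn_gt0 vP i; rewrite /turn /slope /cross e1 e2 !mul0r subr0.
by rewrite ltxx.
Qed.

Lemma sigma_intE f : sigma_int v cs f = \sum_(i < m) (wt i)%:E * I f i.
Proof. by apply: eq_bigr => i _; rewrite /wt EFinM. Qed.

Let I_ge0 (f : T2 -> \bar R) i : (forall x, P x -> 0 <= f x) -> 0 <= I f i.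
Proof.
move=> f0; apply: integral_ge0 => t /=; rewrite in_itv => t01.
by apply: f0; exact: polygon_edge.
Qed.

Lemma sigma_int_ge f i : (forall x, P x -> 0 <= f x) ->
  (cs i * plen (psub (v (ordS i)) (v i)))%:E * \int[mu]_(t in `[0%R, 1%R]) f (edge_pt v i t)
  <= sigma_int v cs f.
Proof.
move=> f0; rewrite sigma_intE (bigD1 i)//= leeDl// sume_ge0// => j _.
by rewrite mule_ge0 ?I_ge0// lee_fin ltW// sigma_weight_gt0.
Qed.

Lemma sigma_int_ge0 f : (forall x, P x -> 0 <= f x) -> 0 <= sigma_int v cs f.
Proof.
move=> f0; rewrite sigma_intE sume_ge0// => j _.
by rewrite mule_ge0 ?I_ge0// lee_fin ltW// sigma_weight_gt0.
Qed.

Lemma sigma_int_eq (f g : R * R -> \bar R) : (forall x, polygon v x -> f x = g x) ->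
  sigma_int v cs f = sigma_int v cs g.
Proof.
move=> fg; rewrite !sigma_intE; apply: eq_bigr => i _; congr (_ * _).
apply: eq_integral => t; rewrite inE/= in_itv => t01.
by apply: fg; exact: polygon_edge.
Qed.

Lemma sigma_intD (f g : T2 -> \bar R) : measurable_fun P f -> measurable_fun P g ->
  (forall x, P x -> 0 <= f x) -> (forall x, P x -> 0 <= g x) ->
  sigma_int v cs (fun x => f x + g x) = sigma_int v cs f + sigma_int v cs g.
Proof.
move=> mf mg f0 g0; rewrite !sigma_intE -big_split/=; apply: eq_bigr => i _.
rewrite -ge0_muleDr ?I_ge0//; congr (_ * _).
have e01 t : (`[0%R, 1%R]%classic : set T1) t -> P (edge_pt v i t).
  by rewrite /= in_itv => t01; exact: polygon_edge.
rewrite /I ge0_integralD//.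
- by move=> t /e01; exact: f0.
- exact: edge_measurable.
- by move=> t /e01; exact: g0.
- exact: edge_measurable.
Qed.

Lemma sigma_intZ (f : T2 -> \bar R) (a : R) : measurable_fun P f -> (0 <= a)%R ->
  (forall x, P x -> 0 <= f x) ->
  sigma_int v cs (fun x => a%:E * f x) = a%:E * sigma_int v cs f.
Proof.
move=> mf a0 f0; rewrite !sigma_intE ge0_sume_distrr; last first.
  by move=> i _; rewrite mule_ge0 ?I_ge0// lee_fin ltW// sigma_weight_gt0.
apply: eq_bigr => i _; rewrite muleCA; congr (_ * _).
rewrite /I ge0_integralZl//.
- exact: edge_measurable.
- by move=> t /=; rewrite in_itv => t01; apply: f0; exact: polygon_edge.
Qed.

Lemma E1_measurable q : E1 c P q -> measurable_fun P (fun x : T2 => expeR (q x)).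
Proof. by move=> [_ [lq _]]; exact: lsc_on_measurable mP (expeR_lsc lq). Qed.

(** A lower bound of [q] makes the integral positive, so [fine] and the inverse in
    [ratio_functional] never take default values. *)
Lemma E1_integral q : E1 c P q ->
  exists2 a : R, (0 < a)%R & \int[@leb2 R]_(x in P) expeR (q x) = a%:E.
Proof.
move=> Eq; have [qNy [lq [cq]]] := Eq.
have [M qM] := lsc_lower_bound vP qNy lq.
have : 0 < \int[@leb2 R]_(x in P) expeR (q x).
  apply: (polygon_integral_gt0 vP (d := expR M)); first exact: E1_measurable Eq.
    exact: expR_gt0.
  by move=> x Px; rewrite -[(expR M)%:E]/(expeR M%:E) lee_expeR; exact: qM.
rewrite /mu_int; case: (\int[_]_(x in _) _) => [a| |] //.
  by rewrite lte_fin => a0 _; exists a.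
by rewrite gt0_muley ?lte_fin.
Qed.

Lemma ratio_functionalE q a : \int[@leb2 R]_(x in P) expeR (q x) = a%:E ->
  ratio_functional c v cs q = sigma_int v cs (fun x => expeR (q x)) * ((c * a)^-1)%:E.
Proof. by move=> qa; rewrite /ratio_functional /mu_int qa. Qed.

(** A competitor of finite ratio, which forces a minimizer to have a finite boundary integral. *)
Lemma E1_cst0 : E1 c P (fun _ => 0).
Proof.
split=> //; split; last split.
- by move=> x _ a a0; exists setT => //; exact: filterT.
- by move=> x y _ _ t _; rewrite !mule0 adde0.
- rewrite /mu_int; under eq_integral do rewrite expeR0.
  have := polygon_measure_lty vP; rewrite -/P.
  have : 0 <= \int[@leb2 R]_(x in P) 1 by exact: integral_ge0.
  by case: (\int[_]_(x in _) _) => [a| |] // _ _; rewrite -EFinM ltry.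
Qed.

Section minimizer.
Variable q : R * R -> \bar R.
Hypothesis Eq : E1 c (polygon v) q.
Hypothesis qmin : forall q', E1 c (polygon v) q' ->
  ratio_functional c v cs q <= ratio_functional c v cs q'.
Let qNy : forall x, P x -> q x != -oo. Proof. by case: Eq. Qed.
Let lq : lsc_on P q. Proof. by case: Eq => _ []. Qed.
Let cq : convex_on P q. Proof. by case: Eq => _ [_ []]. Qed.

Lemma minimizer_sigma_lty : sigma_int v cs (fun x => expeR (q x)) < +oo.
Proof.
have [a a0 qa] := E1_integral Eq; have [b b0 qb] := E1_integral E1_cst0.
have := qmin E1_cst0; rewrite (ratio_functionalE qa) (ratio_functionalE qb).
have : sigma_int v cs (fun=> expeR 0) < +oo.
  rewrite sigma_intE; apply: lte_sum_pinfty => i _.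
  rewrite /I expeR0 integral_cst; last exact: (@measurable_itv R `[0%R, 1%R]).
  by rewrite mul1e -[X in _ * X]/(lebesgue_measure _) lebesgue_measure_itv/= lte_fin ltr01 -EFinB -EFinM ltry.
have : 0 <= sigma_int v cs (fun=> expeR 0).
  by apply: sigma_int_ge0 => x _; exact: expeR_ge0.
have : 0 <= sigma_int v cs (fun x => expeR (q x)).
  by apply: sigma_int_ge0 => x _; exact: expeR_ge0.
case: (sigma_int v cs _) => [s| |] //; first by rewrite ltry.
case: (sigma_int v cs _) => [s| |] // _ _ _.
by rewrite gt0_mulye ?lte_fin ?invr_gt0 ?mulr_gt0// -EFinM leye_eq.
Qed.

Lemma minimizer_edge_lty i t : (0 < t < 1)%R -> q (edge_pt v i t) < +oo.
Proof.
move=> t01; apply: (convex_edge_finite vP) => //.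
have e0 x : P x -> 0 <= expeR (q x) by move=> _; exact: expeR_ge0.
have := le_lt_trans (@sigma_int_ge (fun x => expeR (q x)) i e0) minimizer_sigma_lty.
have := @I_ge0 (fun x => expeR (q x)) i e0; rewrite /I.
case: (\int[_]_(x in _) _) => [a| |] // _; first by move=> _; rewrite ltry.
by rewrite gt0_muley ?lte_fin ?sigma_weight_gt0.
Qed.

Lemma minimizer_trimmed_ub (D : R) : (0 < D < 2^-1)%R ->
  exists B : R, forall x, trimmed v D x -> q x <= B%:E.
Proof.
move=> /andP[D0 D1].
pose b i := (`|fine (q (edge_pt v i D))| + `|fine (q (edge_pt v i (1 - D)))|)%R.
have bB i : (b i <= \sum_i b i)%R.
  by rewrite (bigD1 i)//= lerDl sumr_ge0// => j _; exact: addr_ge0.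
have ub i t : (0 < t < 1)%R -> q (edge_pt v i t) <= (`|fine (q (edge_pt v i t))|)%:E.
  move=> t01; have := minimizer_edge_lty i t01.
  by case: (q _) => [r| |]; rewrite ?ltxx ?leNye// => _; rewrite lee_fin ler_norm.
exists (\sum_i b i)%R => x; apply: (trimmed_ub vP cq); first by rewrite (ltW D0).
- move=> i; apply: le_trans (ub i D _) _; first by lra.
  by rewrite lee_fin (le_trans _ (bB i))// lerDl.
- move=> i; apply: le_trans (ub i (1 - D)%R _) _; first by lra.
  by rewrite lee_fin (le_trans _ (bB i))// lerDr.
Qed.

End minimizer.
End boundary_integral.

(** * The defect of the inf-convolution *)

Section defect_estimates.
Variable R : realType.
Notation mu := (@lebesgue_measure R).
Notation T1 := (measurableTypeR R).
Notation T2 := (T1 * T1)%type.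
Variables (m : nat) (v : 'I_m -> R * R) (c : R) (cs : 'I_m -> R).
Hypotheses (vP : ccw_convex_polygon v) (c0 : (0 < c)%R) (cs0 : forall i, (0 < cs i)%R).
Let P : set T2 := polygon v.
Let mP : measurable P. Proof. exact: polygon_measurable. Qed.
Local Open Scope ereal_scope.
Variable q : R * R -> \bar R.
Hypothesis Eq : E1 c (polygon v) q.
Hypothesis qmin : forall q', E1 c (polygon v) q' ->
  ratio_functional c v cs q <= ratio_functional c v cs q'.
Let qNy : forall x, P x -> q x != -oo. Proof. by case: Eq. Qed.
Let lq : lsc_on P q. Proof. by case: Eq => _ []. Qed.
Let cq : convex_on P q. Proof. by case: Eq => _ [_ []]. Qed.

Variables (w : R * R) (k M : R).
Hypotheses (w1 : w.1 != 0%R) (k0 : (0 < k)%R) (qM : forall x, P x -> M%:E <= q x).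
Let qt := infconv v q w k.
Let df := defect v q w k.
Let w0 : w != (0%R, 0%R).
Proof. by apply/eqP => w0; move: w1; rewrite w0 eqxx. Qed.

Lemma infconv_E1 : E1 c P qt.
Proof.
split; first by move=> x _; exact: (infconv_neqNy w k0 qM x).
split; first exact: (infconv_lsc qNy lq k0 qM).
split; first exact: (infconv_convex cq w k0 qM).
have [a a0 qa] := E1_integral vP c0 Eq.
have : \int[@leb2 R]_(x in P) expeR (qt x) <= a%:E.
  rewrite -qa; apply: ge0_le_integral => //.
  - by move=> x _; exact: expeR_ge0.
  - apply: lsc_on_measurable mP (expeR_lsc _); exact: (infconv_lsc qNy lq k0 qM).
  - exact: (E1_measurable Eq).
  - by move=> x Px; rewrite lee_expeR; exact: infconv_le.
have : 0 <= \int[@leb2 R]_(x in P) expeR (qt x).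
  by apply: integral_ge0 => x _; exact: expeR_ge0.
by rewrite /mu_int; case: (\int[_]_(x in _) _) => [b| |] // _ _; rewrite -EFinM ltry.
Qed.

Lemma defect_measurable : measurable_fun P (df : T2 -> \bar R).
Proof.
apply: measurable_maxe; first exact: measurable_cst.
apply: emeasurable_funB; first exact: (E1_measurable Eq).
exact: (E1_measurable infconv_E1).
Qed.

Lemma segment_midpoint_lty x (e : R) : (0 < e)%R -> P x -> P (ray x w (e + e)) -> q (ray x w e) < +oo.
Proof.
move=> e0 Px Pe; have [D D01 hD] := trimmed_midpoint vP w0 e0.
have [B qB] := minimizer_trimmed_ub vP c0 cs0 Eq qmin D01.
apply: (le_lt_trans (qB _ _)); last exact: ltry.
by apply: hD; rewrite ray_ray// subrr ray0.
Qed.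

(** [qt] is finite at the vertex, being bounded through the midpoint of the inner segment along [w],
    hence at most some [N] on half of edge [j]. By lower semicontinuity [q > N + 1] near the vertex,
    so the defect is at least [exp (N + 1) - exp N] on an initial piece of that edge. *)
Lemma defect_sigma_gt0 j : P (ray (v j) w 1) -> q (v j) = +oo -> 0 < sigma_int v cs df.
Proof.
move=> Pw qj; have Pj := polygon_vertex vP j.
have half : (1 / 2 + 1 / 2 = 1 :> R)%R by field.
have qtj : qt (v j) < +oo.
  have h12 : (0 < 1 / 2 :> R)%R by lra.
  have Pw2 : P (ray (v j) w (1 / 2 + 1 / 2)) by rewrite half.
  have fin := segment_midpoint_lty h12 Pj Pw2.
  have Pm : P (ray (v j) w (1 / 2)).
    have -> : ray (v j) w (1 / 2) = padd (pscale (1 / 2) (v j)) (pscale (1 - 1 / 2) (ray (v j) w 1)).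
      by rewrite /ray /padd /pscale/=; congr pair; field.
    by apply: polygon_conv => //; lra.
  apply: (le_lt_trans (infconv_ray_le q k (ltW h12) Pm)).
  by rewrite lte_add_pinfty// ltry.
pose N := Num.max (fine (qt (v j))) (fine (q (edge_pt v j (1 / 2)))).
have ub (x : \bar R) : x < +oo -> x <= (fine x)%:E by case: x => [r| |]; rewrite ?lexx ?ltxx ?leNye.
have qtN t : (0 <= t <= 1 / 2)%R -> qt (edge_pt v j t) <= N%:E.
  move=> /andP[t0 t1].
  apply: (convex_on_edge vP (infconv_convex cq w k0 qM) (a := 0%R) (b := (1 / 2)%R)); first by rewrite lexx.
  - by rewrite t1/=; lra.
  - have -> : edge_pt v j 0 = v j.
      by rewrite [RHS]surjective_pairing /edge_pt /padd /pscale/=; congr pair; ring.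
    by apply: (le_trans (ub _ qtj)); rewrite lee_fin le_max lexx.
  - have Ph : P (edge_pt v j (1 / 2)) by apply: polygon_edge => //; lra.
    apply: (le_trans (infconv_le _ _ _ Ph)); apply: (le_trans (ub _ _)).
      by apply: (minimizer_edge_lty vP c0 cs0 Eq qmin); lra.
    by rewrite lee_fin le_max lexx orbT.
have N1 : (N + 1)%:E < q (v j) by rewrite qj ltry.
have [V Vj Vq] := lq Pj N1.
have [r r0 rV] : exists2 r : R, (0 < r <= 1 / 2)%R & forall t, (0 <= t <= r)%R -> V (edge_pt v j t).
  have : nbhs (ray (v j) (psub (v (ordS j)) (v j)) 0) V by rewrite ray0.
  move=> /ray_near[[A B] [/nbhs_ballP[r /= r0 rA] /nbhs_singleton Bv] AB].
  exists (Num.min (r / 2) (1 / 2))%R.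
    by rewrite lt_min ge_min lexx orbT andbT divr_gt0//=; lra.
  move=> t /andP[t0]; rewrite le_min => /andP[tr _].
  apply: (AB (t, v j)); split=> //=; apply: rA.
  by rewrite /ball/= sub0r normrN ger0_norm//; lra.
have := r0; move=> /andP[rp rh].
pose d : R := (expR (N + 1) - expR N)%R.
have d0 : (0 < d)%R by rewrite subr_gt0 ltr_expR ltrDl.
have dle t : (0 <= t <= r)%R -> d%:E <= df (edge_pt v j t).
  move=> tr; have th : (0 <= t <= 1 / 2)%R by case/andP: tr => -> /=; move/le_trans; apply.
  have Pt : P (edge_pt v j t) by apply: polygon_edge => //; lra.
  rewrite /df /defect le_max; apply/orP; right.
  rewrite /d EFinB; apply: leeB.
    by rewrite -[(expR _)%:E]/(expeR (N + 1)%:E) lee_expeR ltW// Vq//; exact: rV.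
  by rewrite -[(expR _)%:E]/(expeR N%:E) lee_expeR; exact: qtN.
have df0 x : P x -> 0 <= df x by move=> _; exact: defect_ge0.
apply: lt_le_trans (sigma_int_ge vP cs0 j df0).
rewrite mule_gt0// ?lte_fin ?sigma_weight_gt0//.
apply: (@lt_le_trans _ _ (d%:E * (r - 0)%:E)).
  by rewrite subr0 -EFinM lte_fin mulr_gt0.
apply: integral_itv_ge => //.
- by apply: (le_trans rh); lra.
- exact: (edge_measurable vP _ defect_measurable).
- by move=> t t01; apply: df0; exact: polygon_edge.
- by rewrite lee_fin ltW.
Qed.

Lemma defect_integral_le (e C : R) : (0 < e)%R ->
  (forall x, P x -> P (ray x w (- e)) -> df x = 0) ->
  (forall i, (`|slope v i w| <= C * (cs i * plen (psub (v (ordS i)) (v i))))%R) ->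
  \int[@leb2 R]_(x in P) df x <= (e * C)%:E * sigma_int v cs df.
Proof.
move=> e0 deep hC.
have df0 x : P x -> 0 <= df x by move=> _; exact: defect_ge0.
have dfle x s : P x -> (0 <= s)%R -> P (ray x w s) -> df (ray x w s) <= df x.
  by move=> *; exact: (defect_ray_le cq k0 qM).
apply: (le_trans (slab_bound vP w1 e0 defect_measurable df0 dfle deep)).
have I0 i : 0 <= \int[mu]_(t in `[0%R, 1%R]) df (edge_pt v i t).
  by apply: integral_ge0 => t _; exact: defect_ge0.
rewrite sigma_intE ge0_sume_distrr; last first.
  by move=> i _; rewrite mule_ge0// lee_fin ltW// sigma_weight_gt0.
apply: lee_sum => i _; rewrite muleA -EFinM; apply: lee_wpmul2r => //.
by rewrite lee_fin -mulrA ler_pM2l.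
Qed.

End defect_estimates.

(** * Minimizers *)

Section minimizers.
Variable R : realType.
Notation mu := (@lebesgue_measure R).
Notation T1 := (measurableTypeR R).
Notation T2 := (T1 * T1)%type.
Variables (m : nat) (v : 'I_m -> R * R) (c : R) (cs : 'I_m -> R).
Hypotheses (vP : ccw_convex_polygon v) (c0 : (0 < c)%R) (cs0 : forall i, (0 < cs i)%R).
Let P : set T2 := polygon v.
Let mP : measurable P. Proof. exact: polygon_measurable. Qed.
Local Open Scope ereal_scope.

Section ratio.
Variable q : R * R -> \bar R.
Hypothesis Eq : E1 c (polygon v) q.
Hypothesis qmin : forall q', E1 c (polygon v) q' ->
  ratio_functional c v cs q <= ratio_functional c v cs q'.
Let qNy : forall x, P x -> q x != -oo. Proof. by case: Eq. Qed.
Let lq : lsc_on P q. Proof. by case: Eq => _ []. Qed.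
Let cq : convex_on P q. Proof. by case: Eq => _ [_ []]. Qed.

Lemma minimizer_vertex_lty j : q (v j) < +oo.
Proof.
rewrite ltey; apply/negP => /eqP qj.
have [w w1 Pw] := inner_direction vP j.
have w0 : w != (0%R, 0%R) by apply/eqP => w0; move: w1; rewrite w0 eqxx.
have [M qM] := lsc_lower_bound vP qNy lq.
have [a a0 qa] := E1_integral vP c0 Eq.
have u0 x : P x -> 0 <= expeR (q x) by move=> _; exact: expeR_ge0.
have [s s0 sE] : exists2 s : R, (0 <= s)%R & sigma_int v cs (fun x => expeR (q x)) = s%:E.
  have := minimizer_sigma_lty vP c0 cs0 Eq qmin.
  have := sigma_int_ge0 vP cs0 u0.
  by case: (sigma_int v cs _) => [s| |] // s0 _; exists s.
pose wt i := (cs i * plen (psub (v (ordS i)) (v i)))%R.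
have wt0 i : (0 < wt i)%R by exact: sigma_weight_gt0.
(* Compares the geometric factor [|slope v i w|] of the slab bound with the boundary weight of each
   edge. *)
pose C := (\sum_i `|slope v i w| / wt i)%R.
have C0 : (0 <= C)%R by apply: sumr_ge0 => i _; rewrite divr_ge0// ltW.
have slC i : (`|slope v i w| <= C * wt i)%R.
  rewrite -ler_pdivrMr// /C (bigD1 i)//= lerDl; apply: sumr_ge0 => l _.
  by rewrite divr_ge0// ltW.
have Cs0 : (0 <= C * s)%R by exact: mulr_ge0.
(* Small enough for [e C s < a]; the added 1 keeps the denominator positive when [C s = 0]. *)
pose e := (a / (2 * (1 + C * s)))%R.
have Cs1 : (0 < 2 * (1 + C * s))%R by lra.
have e0 : (0 < e)%R by rewrite divr_gt0.
have heC : (e * (C * s) < a)%R.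
  have eE : (e * (2 * (1 + C * s)) = a)%R by rewrite /e divfK// gt_eqF.
  have : (0 <= e * (C * s))%R by rewrite mulr_ge0// ltW.
  lra.
(* A point [x] at depth [e] is compared with [x - (e / 2) w], the midpoint of a segment in [P],
   where [q] is bounded by some [B]; hence the half step. *)
have e20 : (0 < e / 2)%R by rewrite divr_gt0.
have [D D01 hD] := trimmed_midpoint vP w0 e20.
have [B qB] := minimizer_trimmed_ub vP c0 cs0 Eq qmin D01.
pose k := ((`|B - M| + 1) / (e / 2))%R.
have k0 : (0 < k)%R by rewrite divr_gt0// ltr_wpDl.
have kB : (B - M < k * (e / 2))%R.
  by rewrite /k divfK ?gt_eqF// (le_lt_trans (ler_norm _))// ltrDl.
pose qt := infconv v q w k.
pose df := defect v q w k.
have Eqt : E1 c P qt by exact: (infconv_E1 vP c0 Eq w k0 qM).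
have [b b0 qb] := E1_integral vP c0 Eqt.
have mdf : measurable_fun P (df : T2 -> \bar R) by exact: (defect_measurable vP c0 Eq w k0 qM).
have df0 x : P x -> 0 <= df x by move=> _; exact: defect_ge0.
have ut0 x : P x -> 0 <= expeR (qt x) by move=> _; exact: expeR_ge0.
have mqt := E1_measurable Eqt.
have Iab : a%:E = b%:E + \int[@leb2 R]_(x in P) df x.
  rewrite -qa -qb -ge0_integralD//; apply: eq_integral => x; rewrite inE => Px.
  exact: defectE.
have sD : s%:E = sigma_int v cs (fun x => expeR (qt x)) + sigma_int v cs df.
  rewrite -sE -(sigma_intD cs vP) //; apply: (sigma_int_eq cs vP) => x Px; exact: defectE.
have spos : 0 < sigma_int v cs df.
  exact: (defect_sigma_gt0 vP c0 cs0 Eq qmin w1 k0 qM Pw qj).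
have deep x : P x -> P (ray x w (- e)) -> df x = 0.
  move=> Px Pe; apply: defect_eq0.
  have Pm : P (ray x w (- (e / 2))).
    have -> : ray x w (- (e / 2)) = padd (pscale (1 / 2) x) (pscale (1 - 1 / 2) (ray x w (- e))).
      by rewrite /ray /padd /pscale/=; congr pair; field.
    by apply: polygon_conv => //; lra.
  apply: (infconv_eq cq k0 qM Px e20 Pm _ kB); apply: qB; apply: hD; rewrite ray_ray.
    by rewrite addNr ray0.
  by rewrite (_ : (- (e / 2) + - (e / 2) = - e)%R)//; field.
have Idf := defect_integral_le vP c0 cs0 Eq w1 k0 qM e0 deep slC.
have [d d0 dE] : exists2 d : R, (0 < d)%R & sigma_int v cs df = d%:E.
  move: spos sD; have := sigma_int_ge0 vP cs0 ut0; rewrite -/df.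
  case: (sigma_int v cs df) => [d| |] //; first by rewrite lte_fin; exists d.
  by case: (sigma_int v cs _).
have [t t0 tE] : exists2 t : R, (0 <= t)%R & sigma_int v cs (fun x => expeR (qt x)) = t%:E.
  move: sD; have := sigma_int_ge0 vP cs0 ut0; rewrite dE.
  by case: (sigma_int v cs _) => [t| |] // t0 _; exists t.
have [l l0 lE] : exists2 l : R, (0 <= l)%R & \int[@leb2 R]_(x in P) df x = l%:E.
  move: Iab; have : 0 <= \int[@leb2 R]_(x in P) df x by exact: integral_ge0.
  by case: (\int[_]_(x in _) _) => [l| |] // l0 _; exists l.
move: Idf; rewrite lE dE -EFinM lee_fin => led.
have /eqP := Iab; rewrite lE -EFinD eqe => /eqP abl.
have /eqP := sD; rewrite dE tE -EFinD eqe => /eqP std.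
have := qmin Eqt; rewrite (ratio_functionalE _ _ qa) (ratio_functionalE _ _ qb).
rewrite sE tE -!EFinM lee_fin => h.
have h2 : (s * b <= t * a)%R.
  have h3 : (0 < c * (a * b))%R by rewrite !mulr_gt0.
  move: h; rewrite -(ler_pM2r h3).
  have -> : (s / (c * a) * (c * (a * b)) = s * b)%R by field; rewrite !gt_eqF.
  have -> : (t / (c * b) * (c * (a * b)) = t * a)%R by field; rewrite !gt_eqF.
  by [].
(* Substituting [a = b + l] and [s = t + d] into [s b <= t a]. With [l <= e C d] and division by
   [d > 0] this becomes [a <= e C s], against the choice of [e]. *)
have h3 : (d * a <= s * l)%R by move: h2; rewrite abl std; lra.
have h4 : (s * l <= s * (e * C * d))%R by rewrite ler_wpM2l.
have : (d * a <= d * (e * (C * s)))%R by apply: (le_trans h3); apply: (le_trans h4); lra.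
by rewrite ler_pM2l// leNgt heC.
Qed.

Lemma ratio_minimizer_bounded_continuous : bounded_continuous_on (polygon v) q.
Proof.
exact: (convex_polygon_bounded_continuous vP qNy lq cq minimizer_vertex_lty).
Qed.

End ratio.

(** * Transfer to the normalized functional *)

Lemma bounded_continuous_expeR (f : R * R -> \bar R) :
  bounded_continuous_on (polygon v) f -> bounded_continuous_on (polygon v) (fun x => expeR (f x)).
Proof.
move=> [g [fg [cg [M gM]]]]; exists (expR \o g); split; last split.
- by move=> x /fg ->.
- apply/subspace_continuousP => x Px.
  by apply: (cvg_comp _ _ ((subspace_continuousP _ _).1 cg x Px)); exact: continuous_expR.
- exists (expR M) => x Px; rewrite ger0_norm ?expR_ge0// ler_expR.
  by rewrite (le_trans (ler_norm _))// gM.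
Qed.

Lemma expeR_shift (x : \bar R) (r : R) : expeR (x + r%:E) = (expR r)%:E * expeR x.
Proof. by rewrite expeRD muleC. Qed.

Lemma integral_shift (q : R * R -> \bar R) (r : R) : E1 c (polygon v) q ->
  \int[@leb2 R]_(x in P) expeR (q x + r%:E) = (expR r)%:E * \int[@leb2 R]_(x in P) expeR (q x).
Proof.
move=> Eq; under eq_integral do rewrite expeR_shift.
rewrite ge0_integralZl//; first exact: (E1_measurable Eq).
  by move=> x _; exact: expeR_ge0.
Qed.

(** Adding a constant to [q] scales both integrals of the ratio alike, so any member can be
    normalized. *)
Lemma E1_shift (q : R * R -> \bar R) (r : R) : E1 c (polygon v) q ->
  E1 c (polygon v) (fun x => q x + r%:E).
Proof.
move=> Eq; have [a a0 qa] := E1_integral vP c0 Eq.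
have [qNy [lq [cq _]]] := Eq.
split; first by move=> x /qNy; case: (q x).
split.
  move=> x Px b; rewrite -lteBlDr// -EFinB => /(lq _ Px)[V Vx Vq]; exists V => // y Vy Py.
  by rewrite -lteBlDr// -EFinB; exact: Vq.
split; last by rewrite /mu_int integral_shift// qa -!EFinM ltry.
move=> x y Px Py t t01; have := cq x y Px Py t t01; case/andP: t01 => t0 t1.
have t1' : (0 < 1 - t)%R by rewrite subr_gt0.
have := qNy _ Px; have := qNy _ Py.
case: (q x) => [X| |] //; case: (q y) => [Y| |] // _ _.
- rewrite -[leRHS]/((t * X + (1 - t) * Y)%:E) => h.
  rewrite -[leRHS]/((t * (X + r) + (1 - t) * (Y + r))%:E).
  apply: (le_trans (leeD h (lexx r%:E))).
  by rewrite -[leLHS]/((t * X + (1 - t) * Y + r)%:E) lee_fin; lra.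
- by move=> _; rewrite [+oo + _]addye// [_ * +oo]gt0_muley ?lte_fin// addey ?leey.
- by move=> _; rewrite [+oo + _]addye// [_ * +oo]gt0_muley ?lte_fin// addye ?leey.
- by move=> _; rewrite [+oo + r%:E]addye// !gt0_muley ?lte_fin// leey.
Qed.

Section normalized.
Variable u : R * R -> \bar R.
Hypothesis Mu : M1 c (polygon v) u.
Hypothesis umin : forall u', M1 c (polygon v) u' ->
  U_functional c v cs u <= U_functional c v cs u'.
Let q x := lne (u x).

Let uE x : P x -> expeR (q x) = u x.
Proof.
by move=> Px; apply: lneK; rewrite in_itv/= leey andbT ltW//; case: Mu => /(_ x Px).
Qed.

Let qu : \int[@leb2 R]_(x in P) expeR (q x) = \int[@leb2 R]_(x in P) u x.
Proof. by apply: eq_integral => x; rewrite inE; exact: uE. Qed.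

Lemma M1_lne_E1 : E1 c (polygon v) q.
Proof.
have [u0 [lu [cu mu1]]] := Mu.
split.
  move=> x Px; apply/eqP => qx; have := u0 x Px.
  by rewrite -uE// qx/= ltxx.
split.
  move=> x Px a; rewrite -lte_expeR uE// => /(lu x Px)[V Vx Vu]; exists V => // y Vy Py.
  by rewrite -lte_expeR uE//; exact: Vu.
split=> //; rewrite /mu_int qu -/(mu_int c P u) mu1 /mu_int.
have := polygon_measure_lty vP; rewrite -/P.
have : 0 <= \int[@leb2 R]_(x in P) 1 by exact: integral_ge0.
by case: (\int[_]_(x in _) _) => [a| |] // _ _; rewrite -EFinM ltry.
Qed.

(** A competitor [q'] is shifted until its exponential lies in the normalized class; there the ratio
    and [U_functional] have the same denominator. *)
Lemma M1_minimizer_ratio q' : E1 c (polygon v) q' ->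
  ratio_functional c v cs q <= ratio_functional c v cs q'.
Proof.
move=> Eq'; have [b b0 qb] := E1_integral vP c0 Eq'.
have [a a0 qa] := E1_integral vP c0 M1_lne_E1.
have [u0 [lu [cu mu1]]] := Mu.
have i1 : \int[@leb2 R]_(x in P) 1 = a%:E.
  have c1 : c%:E * \int[@leb2 R]_(x in P) 1 = c%:E * a%:E.
    by rewrite -qa qu; exact/esym.
  move: c1; have : 0 <= \int[@leb2 R]_(x in P) 1 by exact: integral_ge0.
  case: (\int[_]_(x in _) _) => [d| |] // _; last by rewrite gt0_muley ?lte_fin.
  by move=> [/(mulfI _) ->]//; rewrite gt_eqF.
pose r := ln (a / b).
have er : expR r = (a / b)%R by rewrite lnK// posrE divr_gt0.
pose q2 x := q' x + r%:E.
have Eq2 : E1 c (polygon v) q2 by exact: E1_shift.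
have Mq2 : M1 c (polygon v) (fun x => expeR (q2 x)).
  have [nq2 [lq2 [cq2 _]]] := Eq2.
  split; first by move=> x Px; rewrite expeR_gt0// ltNye nq2.
  split; first exact: expeR_lsc.
  split; first by move=> x y Px Py t t01; rewrite !expeRK; exact: cq2.
  rewrite /mu_int integral_shift// -/P i1 qb er -!EFinM.
  by congr EFin; field; rewrite gt_eqF.
have := umin Mq2; rewrite /U_functional /mu_int i1 -EFinM/=.
rewrite (ratio_functionalE _ _ qa) (ratio_functionalE _ _ qb).
rewrite (sigma_int_eq cs vP uE).
have -> : sigma_int v cs (fun x => expeR (q2 x)) = (a / b)%:E * sigma_int v cs (fun x => expeR (q' x)).
  rewrite -(sigma_intZ vP cs0 (E1_measurable Eq')) ?divr_ge0 ?(ltW a0) ?(ltW b0)//; last first.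
    by move=> x _; exact: expeR_ge0.
  by apply: (sigma_int_eq cs vP) => x _; rewrite /q2 expeR_shift er.
rewrite muleA -EFinM [_ * sigma_int _ _ u]muleC => /le_trans; apply.
rewrite muleC le_eqVlt; apply/orP; left; apply/eqP; congr (_ * _%:E).
by field; rewrite !gt_eqF.
Qed.

Lemma U_minimizer_bounded_continuous : bounded_continuous_on (polygon v) u.
Proof.
have [g [gq [cg bg]]] := bounded_continuous_expeR
  (ratio_minimizer_bounded_continuous M1_lne_E1 M1_minimizer_ratio).
by exists g; split=> // x Px; rewrite -gq// uE.
Qed.

End normalized.
End minimizers.

Theorem mainTheorem16 (R : realType) (m : nat) (v : 'I_m -> R * R)
    (c : R) (cs : 'I_m -> R) :
  ccw_convex_polygon v -> 0 < c -> (forall i, 0 < cs i) ->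
  (forall q : R * R -> \bar R,
     E1 c (polygon v) q ->
     (forall q' : R * R -> \bar R, E1 c (polygon v) q' ->
        (ratio_functional c v cs q <= ratio_functional c v cs q')%E) ->
     bounded_continuous_on (polygon v) q) /\
  (forall u : R * R -> \bar R,
     M1 c (polygon v) u ->
     (forall u' : R * R -> \bar R, M1 c (polygon v) u' ->
        (U_functional c v cs u <= U_functional c v cs u')%E) ->
     bounded_continuous_on (polygon v) u).
Proof.
move=> vP c0 cs0; split=> [q Eq qmin|u Mu umin].
- exact: (ratio_minimizer_bounded_continuous vP c0 cs0 Eq qmin).
- exact: (U_minimizer_bounded_continuous vP c0 cs0 Mu umin).
Qed.
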